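(* Let $2<p<\infty$, $r=p/2$, $1/r+1/r'=1$. Let $\mathcal L,\mu,\nu$ be as in the context, let $\beta=\{\beta_{I,I'}\}_{I\in\mathcal L,\,I'\in\operatorname{ch}(I)}$ be an arbitrary numerical sequence, let $\Pi_\beta$ be the corresponding generalized vector paraproduct, and let $b_I=\sum_{I'\in\operatorname{ch}(I)}\beta_{I,I'}\mathbf 1_{I'}$ for $I\in\mathcal L$. There is a finite constant $A$ such that $$\|\Pi_\beta f\|_{\dot{\mathbf g}_p^2(\nu)}^p\le A^p\|f\|_{L^p(\mu)}^p\qquad\text{for all } f\in L^p(\mu)$$ if and only if there are finite constants $B$, $B_*$ such that for all $J\in\mathcal L$ both $$\int_J\Bigl(\sum_{I\in\mathcal L(J)}|b_I|^2\Bigr)^{p/2}d\nu\le B^p\mu(J)$$ and $$\int_J\Bigl[\sum_{I\in\mathcal L(J)}\frac{\nu(I)}{\mu(I)}\,\mathbb E_I^\nu\bigl(|b_I|^2\bigr)\Bigr]^{r'}d\mu\le B_*^{r'}\nu(J)$$ hold. Moreover, the best constants satisfy $\max\{B,c(p)B_*^{1/2}\}\le A\le C(p)\max\{B,B_*^{1/2}\}$, where $0<c(p)$ and $C(p)<\infty$ depend only on $p$.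
   Context: Setup. $(\mathcal X,\mathfrak S)$ is a measurable space carrying a $\sigma$-finite measure $\mu$ and a filtration, i.e. an increasing sequence of $\sigma$-algebras $\mathfrak S_n\subset\mathfrak S_{n+1}\subset\mathfrak S$, $n\in\mathbb Z$. Each $\mathfrak S_n$ is atomic: there is a countable collection $\mathcal L_n$ of disjoint sets of finite measure (atoms, also called intervals) such that each $A\in\mathfrak S_n$ is a union of sets from $\mathcal L_n$; thus each $I\in\mathcal L_n$ is an at most countable union of elements of $\mathcal L_{n+1}$. Put $\mathcal L=\bigcup_{n\in\mathbb Z}\mathcal L_n$. An atom may belong to several, even infinitely many, $\mathcal L_n$, but not to all of them. $\mu,\nu$ are measures on $(\mathcal X,\mathfrak S)$ that are locally finite, i.e. finite on every $I\in\mathcal L$. For $I\in\mathcal L$, $\operatorname{rk} I=\sup\{n: I\in\mathcal L_n\}\in\mathbb Z\cup\{+\infty\}$. If $\operatorname{rk} I=n<\infty$, the children of $I$ are $\operatorname{ch}(I)=\{I'\in\mathcal L_{n+1}: I'\subset I\}$; if $\operatorname{rk} I=\infty$, $\operatorname{ch}(I)=\{I\}$. For $J\in\mathcal L$, $\mathcal L(J)=\{I\in\mathcal L: I\subset J\}$. For a locally finite measure $\sigma$, $\langle f\rangle_{I,\sigma}=\sigma(I)^{-1}\int_I f\,d\sigma$ (and $\langle f\rangle_{I,\sigma}=0$ if $\sigma(I)=0$), and $\mathbb E_I^\sigma f=\langle f\rangle_{I,\sigma}\mathbf 1_I$. In integrals with respect to $\mu$, terms containing $\frac{\nu(I)}{\mu(I)}\mathbb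 E_I^\nu(\cdot)$ with $\mu(I)=0$ are read as $0$ (they are supported on a $\mu$-null set). The generalized vector paraproduct $\Pi_\beta$ maps $f\in L^p(\mu)$ to the sequence $\Pi_\beta f=\{\langle f\rangle_{I,\mu}\beta_{I,I'}\}$ indexed by pairs $(I,I')$ with $I\in\mathcal L$, $I'\in\operatorname{ch}(I)$ (parent $I$, child $I'$). The norm in the Triebel–Lizorkin type sequence space $\dot{\mathbf g}_p^2(\nu)=\dot{\mathbf g}_p^2(\mathcal L,\nu)$ of a sequence $s=\{s_{I,I'}\}$ is $\|s\|_{\dot{\mathbf g}_p^2(\nu)}=\bigl\|\bigl(\sum_{I}\sum_{I'\in\operatorname{ch}(I)}|s_{I,I'}|^2\mathbf 1_{I'}\bigr)^{1/2}\bigr\|_{L^p(\nu)}$. Thus $$\|\Pi_\beta f\|_{\dot{\mathbf g}_p^2(\nu)}^p=\int_{\mathcal X}\Bigl(\sum_{I\in\mathcal L}|\langle f\rangle_{I,\mu}|^2|b_I|^2\Bigr)^{p/2}d\nu .$$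
   Formalization: In the first testing condition the sum over I in L(J) omits the intervals with μ(I)=0, since with them the necessity of that condition and the bound B ≤ A fail; f and β are taken real-valued. *)

(* Defs.v *)
From HB Require Import structures.
From mathcomp Require Export all_boot all_order all_algebra.
From mathcomp Require Export all_classical all_reals all_analysis.

Set Implicit Arguments.
Unset Strict Implicit.
Unset Printing Implicit Defensive.
Import Order.TTheory GRing.Theory Num.Theory.

Local Open Scope classical_set_scope.
Local Open Scope ring_scope.
Local Open Scope ereal_scope.

Section Filtration.
Context {d : measure_display} {X : measurableType d} {R : realType}.

(* [S n] is the n-th sigma-algebra of the filtration and [L n] is the
   collection of its atoms. *)
Record atomic_filtration (mu : {measure set X -> \bar R})
    (S L : int -> set (set X)) : Prop := AtomicFiltration {
  filtration_sigma_algebra : forall n, sigma_algebra [set: X] (S n) ;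
  filtration_measurable : forall n, S n `<=` measurable ;
  filtration_increasing : forall n, S n `<=` S (n + 1)%R ;
  atoms_countable : forall n, countable (L n) ;
  atoms_in_filtration : forall n, L n `<=` S n ;
  atoms_nonempty : forall n I, L n I -> I !=set0 ;
  atoms_disjoint : forall n I I', L n I -> L n I' -> I `&` I' !=set0 -> I = I' ;
  atoms_finite : forall n I, L n I -> mu I < +oo ;
  atoms_generate : forall n A, S n A ->
    exists2 F : set (set X), F `<=` L n & A = \bigcup_(I in F) I ;
  atoms_not_everywhere : forall I, ~ (forall n, L n I) }.

Definition intervals (L : int -> set (set X)) : set (set X) := \bigcup_n L n.

Definition locally_finite (L : int -> set (set X))
    (sigma : {measure set X -> \bar R}) : Prop :=
  forall I, intervals L I -> sigma I < +oo.

Definition subintervals (L : int -> set (set X)) (J : set X) : set (set X) :=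
  [set I | intervals L I /\ I `<=` J].

Definition rk (L : int -> set (set X)) (I : set X) : \bar R :=
  ereal_sup [set (n%:~R)%:E | n in [set n | L n I]].

Definition children (L : int -> set (set X)) (I : set X) : set (set X) :=
  [set I' | (exists n : int, [/\ rk L I = (n%:~R)%:E, L (n + 1)%R I' & I' `<=` I])
            \/ (rk L I = +oo /\ I' = I)].

(* [g] is extended-real valued because |b_I|^2 need not be integrable on I. *)
Definition average (sigma : {measure set X -> \bar R}) (I : set X)
    (g : X -> \bar R) : \bar R :=
  if sigma I == 0 then 0
  else ((fine (sigma I))^-1)%:E * \int[sigma]_(x in I) g x.

Definition cond_exp (sigma : {measure set X -> \bar R}) (I : set X)
    (g : X -> \bar R) (x : X) : \bar R :=
  average sigma I g * (\1_I x)%:E.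

(* The children of I are pairwise disjoint, so at most one term of this
   finitely supported sum is nonzero. *)
Definition b_fun (L : int -> set (set X)) (beta : set X -> set X -> R)
    (I : set X) (x : X) : R :=
  (\sum_(I' \in children L I) beta I I' * \1_I' x)%R.

(* Sequences indexed by the pairs (I, I'), with I' a child of I, are
   represented by functions on all pairs of sets; only the values at such
   pairs are ever used. *)
Definition paraproduct (mu : {measure set X -> \bar R})
    (beta : set X -> set X -> R) (f : X -> R) : set X -> set X -> \bar R :=
  fun I I' => average mu I (EFin \o f) * (beta I I')%:E.

Definition TLnorm (L : int -> set (set X)) (nu : {measure set X -> \bar R})
    (p : R) (s : set X -> set X -> \bar R) : \bar R :=
  'N[nu]_p%:E[ (fun x => (\esum_(I in intervals L)
     \esum_(I' in children L I) (`|s I I'| ^+ 2 * (\1_I' x)%:E)) `^ (2^-1)%R) ].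

Section Conditions.
Variables (L : int -> set (set X)) (mu nu : {measure set X -> \bar R}).
Variables (p r' : R) (beta : set X -> set X -> R).

Definition paraproduct_bound (A : R) : Prop :=
  forall f : X -> R, f \in Lfun mu p%:E ->
    TLnorm L nu p (paraproduct mu beta f) `^ p
      <= (A `^ p)%:E * 'N[mu]_p%:E[EFin \o f] `^ p.

(* The intervals with mu I = 0 are left out of the sum: the averages over
   them vanish by convention, so that they do not contribute to the
   paraproduct either. If mu I > 0 for all intervals I, this restriction is
   void. Without it, necessity fails: take X = {x, y}, mu and nu the Dirac
   masses at x and y, L n = {X} for n <= 0 and {{x}, {y}} for n > 0, and let
   beta be 1 at ({y}, {y}) and 0 elsewhere. The paraproduct is then 0, but
   \int_J (\sum |b_I|^2)^(p/2) dnu = 1 > 0 = mu J for J = {y}. *)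
Definition direct_testing (B : R) : Prop :=
  forall J, intervals L J ->
    \int[nu]_(x in J)
       (\esum_(I in [set I | subintervals L J I /\ mu I != 0])
          (`|b_fun L beta I x| ^+ 2)%:E) `^ (p / 2)%R
      <= (B `^ p)%:E * mu J.

(* Division by 0 in R yields 0, so the terms with mu I = 0 vanish. *)
Definition dual_testing (Bs : R) : Prop :=
  forall J, intervals L J ->
    \int[mu]_(x in J)
       (\esum_(I in subintervals L J)
          ((fine (nu I) / fine (mu I))%:E *
           cond_exp nu I (fun y => (`|b_fun L beta I y| ^+ 2)%:E) x)) `^ r'
      <= (Bs `^ r')%:E * nu J.

End Conditions.

(* The best constant is +oo when no finite constant is admissible. *)
Definition best_constant (P : R -> Prop) : \bar R :=
  ereal_inf [set A%:E | A in [set A : R | (0 <= A)%R /\ P A]].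

End Filtration.

(* Main.v *)
Require Import Defs.
From mathcomp Require Import all_boot all_order all_algebra.
From mathcomp Require Import all_classical all_reals all_analysis.
From mathcomp Require Import measurable_realfun ring lra.
Import Order.TTheory GRing.Theory Num.Theory.
Local Open Scope classical_set_scope.
Local Open Scope ring_scope.

(** Write alpha(I, I') for the square of beta(I, I') and <f>_I for the mean of
    f over I. By monotone convergence it is enough to work with finite families
    of pairs (I, I'), I' a child of I, as long as the constants do not depend on
    the family. All intervals in sight then form a finite laminar family.

    Testing implies boundedness. Let T be the sum of alpha(I, I') <f>_I^2 1_I'
    over a finite family, with f >= 0. Testing T against a multiple g of
    T^(r-1) turns the L^r(nu) norm of T into the form
      sum of alpha(I, I') <f>_I^2 <g>_I' nu(I'),
    where f is averaged with respect to mu and g with respect to nu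
    ([finite_sufficiency]). Choose stopping intervals for the means of f and,
    independently, for the means of g ([stopping_family]): the means double from
    one stopping interval to the next one inside it, and the mean over any
    interval is at most twice the mean over the least stopping interval
    containing it. So a pair e = (I, I') may be charged to the stopping
    interval F(e) of I for f and the stopping interval G(e) of I' for g
    ([bilinear_estimate]). The point is that one of the two always determines
    the other:
     - if F(e) is contained in G(e), then G(e) is the least stopping interval
       for g that contains F(e);
     - if I and G(e) are contained in G(e) and F(e) respectively, then F(e) is
       the least stopping interval for f that contains G(e);
     - otherwise G(e) lies strictly inside I and contains I', so it is I' itself,
       and I is the only proper parent of I'.
    Whenever G(e) determines F(e), group the pairs by F(e). The direct condition
    on F(e) controls the sum of alpha 1_I' over a group in L^r(nu), the means of
    g in the group are dominated by the l^r' sum over the intervals G(e) of the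
    group, and no G(e) is counted in two groups ([corona_pairing]). In the first
    case the roles of F and G are exchanged and the dual condition is used.
    What remains are the sums of <f>_S^p mu(S) and <g>_S^r' nu(S) over stopping
    intervals, which are bounded by the norms of f and g
    ([carleson_stopping]). Young's inequality is applied at each point, which keeps
    all estimates additive; rescaling g then gives the bound for T.

    Boundedness implies testing. The direct condition is the bound for
    f = 1_J. For the dual condition let h be the function in the bracket,
    restricted to a finite family. Its r'-norm is attained by pairing h with
    h^(r'-1), which produces the linear means <h^(r'-1)>_I instead of the squares
    <f>_I^2. If f is the square root of the maximal function of h^(r'-1), then
    <f>_I^2 >= <h^(r'-1)>_I, and the maximal function is bounded on L^r by the
    Carleson embedding ([maximal_square_root], [finite_dual_necessity]). *)

Set Implicit Arguments.
Unset Strict Implicit.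
Unset Printing Implicit Defensive.

(** * Powers and conjugate exponents *)

Section numeric.
Context {R : realType}.
Implicit Types a b r s x y : R.

Lemma ler_powR2r r x y : 0 <= r -> 0 <= x -> x <= y -> x `^ r <= y `^ r.
Proof. by move=> r0 x0 xy; apply: ge0_ler_powR; rewrite ?nnegrE// (le_trans x0). Qed.

Lemma conjugate_gt1 r s : 0 < r -> 0 < s -> r^-1 + s^-1 = 1 -> 1 < r.
Proof.
move=> r0 s0 rs; rewrite -[ltRHS]invrK invf_gt1 ?invr_gt0//.
by rewrite -rs ltrDl invr_gt0.
Qed.

Lemma powRV a r : 0 <= a -> a^-1 `^ r = (a `^ r)^-1.
Proof. by move=> a0; rewrite -[in LHS]powR_inv1// -powRrM mulN1r powRN. Qed.

Lemma powR_div a b r : 0 <= a -> 0 <= b -> (a / b) `^ r = a `^ r / b `^ r.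
Proof. by move=> a0 b0; rewrite powRM ?invr_ge0// powRV. Qed.

Lemma conjugate_gt0 r s : 1 < r -> r^-1 + s^-1 = 1 -> 0 < s.
Proof.
move=> r1 rs; rewrite -invr_gt0; have -> : s^-1 = 1 - r^-1 by rewrite -rs; ring.
by rewrite subr_gt0 invf_lt1// (lt_trans ltr01).
Qed.

Lemma conjugate_mul r s : 0 < r -> 0 < s -> r^-1 + s^-1 = 1 -> (r - 1) * s = r.
Proof.
move=> r0 s0 /(congr1 (fun t => t * r * s)).
rewrite mul1r !mulrDl mulVf ?gt_eqF// -(mulrA _ r) (mulrC r) mulrA mulVf ?gt_eqF//.
by move=> rs; lra.
Qed.

(** The factors 1/r and 1/s are dropped: only the order of magnitude of the
    constants matters later on. *)
Lemma young r s a b : 0 < r -> 0 < s -> r^-1 + s^-1 = 1 ->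
  0 <= a -> 0 <= b -> a * b <= a `^ r + b `^ s.
Proof.
move=> r0 s0 rs a0 b0; apply: (le_trans (conjugate_powR a0 b0 r0 s0 rs)).
have r1 := conjugate_gt1 r0 s0 rs.
have s1 : 1 < s by apply: (conjugate_gt1 s0 r0); rewrite addrC.
by apply: lerD; rewrite ler_pdivrMr// ler_peMr ?powR_ge0// ltW.
Qed.

(** The sum of the geometric series of ratio [2 `^ (- r)]. *)
Definition geometric_bound r : R := (1 - 2 `^ (- r))^-1.

Lemma geometric_bound_lt1 r : 0 < r -> 0 < 1 - 2 `^ (- r).
Proof.
move=> r0; rewrite subr_gt0 powRN invf_lt1 ?powR_gt0//.
by rewrite -[ltLHS](powRr0 2) /powR ifF ?gt_eqF// ltr_expR ltr_pM2r// ln_gt0// ltr1n.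
Qed.

Lemma geometric_bound_gt0 r : 0 < r -> 0 < geometric_bound r.
Proof. by move=> r0; rewrite invr_gt0 geometric_bound_lt1. Qed.

(** Values that pairwise differ by a factor of more than 2 decrease
    geometrically once they are sorted, so their sum is comparable with the
    largest one. *)
Lemma sum_geometric_growth (T : eqType) (t : seq T) (a : T -> R) r b :
  0 < r -> 0 <= b -> uniq t -> (forall i, 0 <= a i) ->
  (forall i, i \in t -> a i <= b) ->
  (forall i j, i \in t -> j \in t -> i != j -> 2 * a i < a j \/ 2 * a j < a i) ->
  \sum_(i <- t) a i `^ r <= geometric_bound r * b `^ r.
Proof.
move=> r0; have [n] := ubnP (size t); elim: n t b => // n IH t b.
rewrite ltnS => tn b0 ut a0 ab grow.
have [->|] := eqVneq t [::].
  by rewrite big_nil mulr_ge0 ?powR_ge0// ltW// geometric_bound_gt0.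
move=> /eqP t0.
(* Induction on the number of values: the ones other than the maximum [a m]
   are bounded by [a m / 2]. *)
have [m mt mP] : exists2 m, m \in t & forall i, i \in t -> a i <= a m.
  elim: t t0 {tn ut ab grow IH} => // x t IH _.
  have [->|/eqP/IH[m mt mP]] := eqVneq t [::].
    by exists x; rewrite ?mem_head// => i; rewrite inE => /eqP ->.
  have [xm|/ltW mx] := leP (a x) (a m).
    exists m; rewrite ?inE ?mt ?orbT// => i.
    by rewrite inE => /predU1P[->//|/mP].
  exists x; rewrite ?mem_head// => i.
  by rewrite inE => /predU1P[->//|/mP/le_trans->].
rewrite (perm_big _ (perm_to_rem mt)) big_cons.
have memr i : i \in rem m t -> i \in t by exact: mem_rem.
have : \sum_(i <- rem m t) a i `^ r <= geometric_bound r * (a m / 2) `^ r.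
  apply: IH.
  - by rewrite (leq_trans _ tn)// size_rem// prednK// lt0n size_eq0; apply/eqP.
  - by rewrite divr_ge0.
  - exact: rem_uniq.
  - exact: a0.
  - move=> i; rewrite mem_rem_uniq// !inE => /andP[im it].
    have := mP _ it; case: (grow _ _ it mt im); first by lra.
    by have := a0 i; lra.
  - by move=> i j /memr it /memr jt; exact: grow.
move=> IH'; apply: (@le_trans _ _ (geometric_bound r * a m `^ r)); last first.
  by rewrite ler_wpM2l ?(ltW (geometric_bound_gt0 r0))// ler_powR2r ?ab// ltW.
apply: (le_trans (lerD (lexx _) IH')); rewrite powRM ?invr_ge0//.
have -> : 2^-1 `^ r = 2 `^ (- r) :> R.
  by rewrite powRN powRV.
have := geometric_bound_lt1 r0; rewrite /geometric_bound; set q := 2 `^ (- r) => q1.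
rewrite le_eqVlt; apply/orP; left; apply/eqP; field.
by rewrite gt_eqF.
Qed.

(** The constant of the Carleson embedding below with exponent [r]. *)
Definition carleson_constant r : R := geometric_bound (r - 1) `^ r.

Lemma carleson_constant_gt0 r : 1 < r -> 0 < carleson_constant r.
Proof. by move=> r1; rewrite powR_gt0// geometric_bound_gt0// subr_gt0. Qed.

Lemma half_absorption x y : x <= 2^-1 * x + y -> x <= 2 * y.
Proof. by lra. Qed.

(** The end of the duality argument: [Z `^ (- (r - 1))] is the scale of the dual
    function and [y] the finite quantity to be bounded; the term with [k2] is at
    most half of the left-hand side. *)
Lemma rescaled_absorption r Z c k1 k2 y w :
  0 < Z -> 0 <= c -> 0 <= k1 -> 0 <= k2 -> 0 <= y -> 0 <= w ->
  Z = 2 * (c * (k1 + k2)) ->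
  Z `^ (- (r - 1)) * y <= c * (k1 * w + k2 * (Z `^ (- r) * y)) ->
  y <= Z `^ r * w.
Proof.
move=> Z0 c0 k10 k20 y0 w0 ZE key; set s := Z `^ (- (r - 1)) in key.
have s0 : 0 < s by exact: powR_gt0.
have ZsE : Z * Z `^ (- r) = s.
  rewrite /s -[X in X * _](powRr1 (ltW Z0)) -powRD; last by rewrite (gt_eqF Z0) implybT.
  by congr (_ `^ _); ring.
have Zr : Z `^ (- r) * Z `^ r = 1.
  by rewrite powRN mulVf// gt_eqF// powR_gt0.
set q := Z `^ (- r) in key ZsE Zr; have q0 : 0 <= q by exact: powR_ge0.
have bound : c * (k1 * w + k2 * (q * y)) <= c * (k1 + k2) * (w + q * y).
  rewrite -[leRHS]mulrA; apply: ler_wpM2l => //.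
  have qy0 : 0 <= q * y by exact: mulr_ge0.
  have := mulr_ge0 k10 qy0; have := mulr_ge0 k20 w0.
  by rewrite mulrDr !(mulrDl k1); lra.
rewrite -(ler_pM2l s0) -{2}ZsE mulrA -(mulrA Z) Zr mulr1.
have half : c * (k1 + k2) * (q * y) = s * y / 2.
  by rewrite -ZsE ZE; field.
have half' : c * (k1 + k2) * w = Z * w / 2 by rewrite ZE; field.
by move: (le_trans key bound); rewrite mulrDr half half'; lra.
Qed.

End numeric.

(** * Integrals of finite sums *)

Section integrals.
Context {d} {X : measurableType d} {R : realType}.
Variable mu : {measure set X -> \bar R}.

Lemma measurable_sum_seq (T : eqType) (E : seq T) (P : pred T) (f : T -> X -> R) :
  (forall e, e \in E -> measurable_fun [set: X] (f e)) ->
  measurable_fun [set: X] (fun x => \sum_(e <- E | P e) f e x).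
Proof.
elim: E => [|e E IH] mf; first by under eq_fun do rewrite big_nil; exact: measurable_cst.
have mE : measurable_fun [set: X] (fun x => \sum_(e <- E | P e) f e x).
  by apply: IH => i iE; apply: mf; rewrite inE iE orbT.
under eq_fun do rewrite big_cons.
case: (P e) => //; apply: measurable_funD => //.
by apply: mf; rewrite mem_head.
Qed.

Lemma measurable_fun_powR (f : X -> R) (r : R) : measurable_fun [set: X] f ->
  measurable_fun [set: X] (fun x => f x `^ r).
Proof.
by move=> mf; apply: (@measurableT_comp _ _ _ _ _ _ (fun y : R => y `^ r)).
Qed.

Lemma integral_sum_seq (T : eqType) (E : seq T) (P : pred T) (f : T -> X -> R) :
  (forall e, e \in E -> measurable_fun [set: X] (f e)) ->
  (forall e x, e \in E -> 0 <= f e x) ->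
  (\int[mu]_x (\sum_(e <- E | P e) f e x)%:E =
   \sum_(e <- E | P e) \int[mu]_x (f e x)%:E)%E.
Proof.
elim: E => [|e E IH] mf f0.
  by under eq_integral do rewrite big_nil; rewrite integral0 big_nil.
have mE i : i \in E -> measurable_fun [set: X] (f i).
  by move=> iE; apply: mf; rewrite inE iE orbT.
have f0E i x : i \in E -> 0 <= f i x.
  by move=> iE; apply: f0; rewrite inE iE orbT.
under eq_integral do rewrite big_cons.
rewrite big_cons; case: ifPn => Pe; last exact: IH.
under eq_integral do rewrite EFinD.
rewrite ge0_integralD//= ?IH//.
- by move=> x _; rewrite lee_fin f0// mem_head.
- by apply/measurable_EFinP; apply: mf; rewrite mem_head.
- by move=> x _; rewrite lee_fin big_seq_cond sumr_ge0// => i /andP[iE _]; exact: f0E.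
- by apply/measurable_EFinP; exact: measurable_sum_seq.
Qed.

Lemma integralZ_ge0 (k : R) (f : X -> R) : 0 <= k -> measurable_fun [set: X] f ->
  (forall x, 0 <= f x) ->
  (\int[mu]_x (k * f x)%:E = k%:E * \int[mu]_x (f x)%:E)%E.
Proof.
move=> k0 mf f0; under eq_integral do rewrite EFinM.
rewrite ge0_integralZl//; first exact/measurable_EFinP.
by move=> x _; rewrite lee_fin.
Qed.

Lemma integral_mul_indic (f : X -> R) (S : set X) : measurable S ->
  (\int[mu]_x (f x * \1_S x)%:E = \int[mu]_(x in S) (f x)%:E)%E.
Proof.
move=> mS; rewrite [RHS]integral_mkcond; apply: eq_integral => x _.
rewrite patchE indicE; case: ifPn => _; first by rewrite mulr1.
by rewrite mulr0.
Qed.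

Lemma integral_indic1 (S : set X) : measurable S ->
  (\int[mu]_x (\1_S x : R)%:E = mu S)%E.
Proof. by move=> mS; rewrite integral_indic// setIT. Qed.

Lemma measurable_indic_scale (k : R) (S : set X) : measurable S ->
  measurable_fun [set: X] (fun x => k * \1_S x).
Proof. by move=> mS; apply: measurable_funM => //; exact: measurable_indic. Qed.

Lemma integral_step (T : eqType) (E : seq T) (P : pred T) (k : T -> R)
    (Q : T -> set X) :
  (forall e, e \in E -> measurable (Q e)) -> (forall e, e \in E -> 0 <= k e) ->
  (\int[mu]_x (\sum_(e <- E | P e) k e * \1_(Q e) x)%:E =
   \sum_(e <- E | P e) (k e)%:E * mu (Q e))%E.
Proof.
move=> mQ k0; rewrite integral_sum_seq.
- rewrite big_seq_cond [RHS]big_seq_cond; apply: eq_bigr => e /andP[eE _].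
  have mQe := mQ _ eE.
  by rewrite integralZ_ge0 ?k0 ?integral_indic1//; exact: measurable_indic.
- by move=> e eE; apply: measurable_indic_scale; exact: mQ.
- by move=> e x eE; rewrite mulr_ge0 ?k0.
Qed.

End integrals.

Section average.
Context {d} {X : measurableType d} {R : realType}.
Variable mu : {measure set X -> \bar R}.
Implicit Types (f : X -> R) (I : set X).

(** A total real-valued mean, for nonnegative functions; it is 0 when the measure
    of [I] is 0, so that [integral_mean] holds for null sets as well. *)
Definition mean f I : R := fine (\int[mu]_(x in I) (f x)%:E) / fine (mu I).

Lemma mean_ge0 f I : (forall x, 0 <= f x) -> 0 <= mean f I.
Proof.
move=> f0; rewrite divr_ge0// fine_ge0//.
by apply: integral_ge0 => x _; rewrite lee_fin.
Qed.

Lemma integral_mean f I : measurable I -> (mu I < +oo)%E ->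
  measurable_fun [set: X] f -> (forall x, 0 <= f x) ->
  (\int[mu]_(x in I) (f x)%:E < +oo)%E ->
  (\int[mu]_(x in I) (f x)%:E = (mean f I)%:E * mu I)%E.
Proof.
move=> mI Ioo mf f0 foo.
have [I0|I0] := eqVneq (mu I) 0%E.
  rewrite I0 mule0; apply: null_set_integral => //; apply/measurable_EFinP.
  exact: measurable_funS mf.
have Ifin : mu I \is a fin_num by rewrite ge0_fin_numE.
rewrite -[mu I in RHS]fineK// -EFinM /mean divfK ?fine_eq0// fineK// ge0_fin_numE//.
by apply: integral_ge0 => x _; rewrite lee_fin.
Qed.

Lemma bounded_integral_lty f I (b : R) : measurable I -> (mu I < +oo)%E ->
  measurable_fun [set: X] f -> (forall x, 0 <= f x) -> (forall x, f x <= b) ->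
  (\int[mu]_(x in I) (f x)%:E < +oo)%E.
Proof.
move=> mI Ioo mf f0 fb.
apply: (@le_lt_trans _ _ (\int[mu]_(x in I) (cst `|b|%:E x))%E).
  apply: ge0_le_integral => //.
  - by move=> x _; rewrite lee_fin.
  - by apply/measurable_EFinP; exact: measurable_funS mf.
  - by move=> x _; rewrite lee_fin (le_trans (fb x))// ler_norm.
by rewrite integral_cst// lte_mul_pinfty// lee_fin.
Qed.

Lemma step_powR_integral_lty (T : eqType) (E : seq T) (k : T -> R)
    (Q : T -> set X) (q : R) : 1 <= q ->
  (forall e, e \in E -> measurable (Q e)) ->
  (forall e, e \in E -> (mu (Q e) < +oo)%E) ->
  (forall e, e \in E -> 0 <= k e) ->
  (\int[mu]_x ((\sum_(e <- E) k e * \1_(Q e) x) `^ q)%:E < +oo)%E.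
Proof.
move=> q1 mQ Qoo k0; pose h x : R := \sum_(e <- E) k e * \1_(Q e) x.
have q0 : 0 < q by exact: lt_le_trans q1.
have h0 x : 0 <= h x by rewrite /h big_seq sumr_ge0// => e eE; rewrite mulr_ge0 ?k0.
have mh : measurable_fun [set: X] h.
  by apply: measurable_sum_seq => e eE; apply: measurable_indic_scale; exact: mQ.
pose b := \sum_(e <- E) k e.
have hb x : h x <= b.
  rewrite /h /b big_seq [leRHS]big_seq; apply: ler_sum => e eE.
  by rewrite ler_piMr ?k0// indicE lern1 leq_b1.
apply: (@le_lt_trans _ _ (\int[mu]_x (b `^ (q - 1) * h x)%:E)%E).
  apply: ge0_le_integral => //.
  - by move=> x _; rewrite lee_fin powR_ge0.
  - by apply/measurable_EFinP; exact: measurable_fun_powR.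
  - by apply/measurable_EFinP; apply: measurable_funM.
  move=> x _; rewrite lee_fin -/(h x) -(mulr_powRB1 (h0 x) q0) mulrC ler_wpM2r//.
  by apply: ler_powR2r => //; rewrite subr_ge0.
rewrite integralZ_ge0 ?powR_ge0// integral_step//.
rewrite lte_mul_pinfty ?lee_fin ?powR_ge0//.
rewrite big_seq; apply/lte_sum_pinfty => e eE.
by rewrite lte_mul_pinfty ?lee_fin ?k0 ?Qoo.
Qed.

End average.

(** * Countable sums as monotone limits of finite sums *)

Section exhaustion.
Context {R : realType} {T : choiceType}.
Local Open Scope ereal_scope.

Lemma esum_ge_seq (P : set T) (s : seq T) (a : T -> \bar R) : uniq s ->
  (forall i, i \in s -> P i) -> (forall i, P i -> 0 <= a i) ->
  \sum_(i <- s) a i <= \esum_(i in P) a i.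
Proof.
move=> us sP a0; apply: esum_ge; exists [set` s].
  by split; [exact: finite_seq|exact: sP].
by rewrite fsbig_seq.
Qed.

(** The exhausting finite families are chosen before the summand, so that a sum
    of functions of a point is exhausted by the same families at all points.
    The element [t0] is a default value for the inverse of an enumeration. *)
Lemma countable_exhaustion (t0 : T) (P : set T) : countable P ->
  exists s : nat -> seq T, [/\ forall n, uniq (s n),
    forall n i, i \in s n -> P i &
    forall a : T -> \bar R, (forall i, P i -> 0 <= a i) ->
      nondecreasing_seq (fun n => \sum_(i <- s n) a i) /\
      \sum_(i <- s n) a i @[n --> \oo] --> \esum_(i in P) a i].
Proof.
move=> /countable_injP[f finj].
have [g gf] : exists g : nat -> T, forall i, P i -> g (f i) = i.
  have /choice[g gP] : forall n, exists t, forall i, P i -> f i = n -> t = i.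
    move=> n; have [[i [Pi <-]]|nP] := pselect (exists i, P i /\ f i = n).
      by exists i => j Pj fij; apply: finj; rewrite ?inE.
    by exists t0 => i Pi fi; exfalso; apply: nP; exists i.
  by exists g => i Pi; exact: gP.
pose D := [pred n | n \in f @` P].
have gD n : n \in D -> P (g n) /\ f (g n) = n.
  by move=> nD; have [i Pi <-] := set_mem (nD : n \in f @` P); rewrite gf.
pose s n := [seq g i | i <- iota 0 n & D i].
have sE (a : T -> \bar R) n : \sum_(i <- s n) a i = \sum_(0 <= i < n | D i) a (g i).
  by rewrite /s big_map big_filter /index_iota subn0.
exists s; split.
- move=> n; rewrite map_inj_in_uniq ?filter_uniq ?iota_uniq// => i j.
  rewrite !mem_filter => /andP[/gD[_ fi] _] /andP[/gD[_ fj] _] gij.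
  by rewrite -fi -fj gij.
- by move=> n i /mapP[j]; rewrite mem_filter => /andP[/gD[Pj _] _] ->.
move=> a a0; have a0D n : D n -> 0 <= a (g n) by move=> /gD[Pn _]; exact: a0.
under eq_fun do rewrite sE; split.
  by move=> m n mn; apply: lee_sum_nneg_natr => // k _; exact: a0D.
have -> : \esum_(i in P) a i = \sum_(i <oo | D i) a (g i).
  rewrite nneseries_esum//.
  have -> : [set x | D x] = f @` P.
    by apply/seteqP; split => n; rewrite /D /=; [exact: set_mem|exact: mem_set].
  rewrite esum_image; last exact: finj.
  by apply: eq_esum => i Pi; rewrite gf.
by apply: (cvg_toP (is_cvg_nneseries_cond _)) => // n _; exact: a0D.
Qed.

End exhaustion.

Section esum_extra.
Context {R : realType} {T : choiceType}.
Local Open Scope ereal_scope.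

Lemma le_esum_subset (P Q : set T) (a b : T -> \bar R) : P `<=` Q ->
  (forall i, P i -> a i <= b i) -> \esum_(i in P) a i <= \esum_(i in Q) b i.
Proof.
move=> PQ ab; apply: (le_trans (le_esum ab)); apply: ge_ereal_sup => _ [F [fF FP] <-].
by apply: ereal_sup_ubound; exists F => //; split => //; exact: subset_trans PQ.
Qed.

(** Only one inequality has to be proved, since a positive [c] is invertible. *)
Lemma esumZl (P : set T) (a : T -> \bar R) (c : R) : (0 <= c)%R ->
  (forall i, P i -> 0 <= a i) ->
  c%:E * (\esum_(i in P) a i) = \esum_(i in P) (c%:E * a i).
Proof.
have le (k : R) (f : T -> \bar R) : (0 <= k)%R -> (forall i, P i -> 0 <= f i) ->
    \esum_(i in P) (k%:E * f i) <= k%:E * (\esum_(i in P) f i).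
  move=> k0 f0; apply: ge_ereal_sup => _ [F [fF FP] <-].
  rewrite fsbig_finite//= big_seq -ge0_sume_distrr; last first.
    by move=> i; rewrite in_fset_set// inE => /FP/f0.
  rewrite -big_seq -fsbig_finite//; apply: lee_wpmul2l; first by rewrite lee_fin.
  by apply: ereal_sup_ubound; exists F.
rewrite le_eqVlt => /predU1P[<- a0|c0 a0].
  by rewrite mul0e esum1// => i _; rewrite mul0e.
apply/eqP; rewrite eq_le le ?(ltW c0)// andbT.
rewrite -lee_pdivlMl//.
rewrite (@eq_esum _ _ P a (fun i => c^-1%:E * (c%:E * a i))); last first.
  by move=> i _; rewrite muleA -EFinM mulVf ?gt_eqF// mul1e.
by apply: le; [rewrite invr_ge0 ltW|move=> i /a0 ai; rewrite mule_ge0// lee_fin ltW].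
Qed.

Lemma esum_supported1 (P : set T) (t : T) (a : T -> \bar R) : P t ->
  0 <= a t -> (forall i, P i -> i <> t -> a i = 0) -> \esum_(i in P) a i = a t.
Proof.
move=> Pt at0 a0; rewrite -(esum_set1 at0) esum_mkcond [RHS]esum_mkcond.
apply: eq_esum => i _; have [->|it] := pselect (i = t).
  by rewrite !mem_set.
rewrite [i \in [set t]]memNset//; case: ifPn => // iP.
by apply: a0 => //; exact: set_mem iP.
Qed.

End esum_extra.

Section esum_integral.
Context {d} {X : measurableType d} {R : realType} {T : choiceType}.
Variables (mu : {measure set X -> \bar R}) (t0 : T) (P : set T).
Hypothesis cP : countable P.
Local Open Scope ereal_scope.

Lemma measurable_fun_esum (k : T -> X -> \bar R) :
  (forall i, P i -> measurable_fun [set: X] (k i)) ->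
  (forall i x, P i -> 0 <= k i x) ->
  measurable_fun [set: X] (fun x => \esum_(i in P) k i x).
Proof.
move=> mk k0; have [s [us sP sa]] := @countable_exhaustion R _ t0 _ cP.
apply: (emeasurable_fun_cvg (fun n x => \sum_(i <- s n) k i x)); last first.
  by move=> x _; have /sa[] : forall i, P i -> 0 <= k i x by move=> i; exact: k0.
move=> n; under eq_fun do rewrite big_seq.
rewrite (_ : (fun x => _) = (fun x => \sum_(i <- s n) (if i \in s n then k i x else 0))).
  apply: emeasurable_sum => i; case: (boolP (i \in s n)) => [/sP Pi|_] /=.
    exact: mk.
  exact: measurable_cst.
by apply/funext => x; rewrite -big_mkcond.
Qed.

Lemma integral_esum (k : T -> X -> R) :
  (forall i, P i -> measurable_fun [set: X] (k i)) ->
  (forall i x, P i -> 0 <= k i x)%R ->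
  \int[mu]_x (\esum_(i in P) (k i x)%:E) = \esum_(i in P) (\int[mu]_x (k i x)%:E).
Proof.
move=> mk k0; have [s [us sP sa]] := @countable_exhaustion R _ t0 _ cP.
pose g n x : \bar R := \sum_(i <- s n) (k i x)%:E.
have gx x : nondecreasing_seq (g ^~ x) /\ g n x @[n --> \oo] --> \esum_(i in P) (k i x)%:E.
  by apply: sa => i Pi; rewrite lee_fin k0.
have gE n x : g n x = (\sum_(i <- s n) k i x)%:E by rewrite /g sumEFin.
transitivity (\int[mu]_x limn (g ^~ x)).
  by apply: eq_integral => x _; have [_ /cvg_lim ->] := gx x.
rewrite monotone_convergence//.
- apply/cvg_lim => //.
  have -> : (fun n => \int[mu]_x g n x) =
            (fun n => \sum_(i <- s n) \int[mu]_x (k i x)%:E).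
    apply/funext => n; under eq_integral do rewrite gE.
    by apply: integral_sum_seq => [i /sP|i x /sP]; [exact: mk|exact: k0].
  suff /sa[] : forall i, P i -> 0 <= \int[mu]_x (k i x)%:E by [].
  by move=> i Pi; apply: integral_ge0 => x _; rewrite lee_fin k0.
- move=> n; rewrite (_ : g n = EFin \o (fun x => \sum_(i <- s n) k i x)%R); last first.
    by apply/funext => x; exact: gE.
  apply/measurable_EFinP.
  by apply: measurable_sum_seq => i /sP; exact: mk.
- move=> n x _; rewrite gE lee_fin big_seq sumr_ge0// => i /sP iP.
  exact: k0.
- by move=> x _; exact: (gx x).1.
Qed.

(** Bounds for finite families pass to countable ones; this is how the finite
    estimates below are transferred to all intervals. *)
Lemma integral_esum_poweR_le (q : R) (M : \bar R) (k : T -> X -> R) : (0 < q)%R ->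
  (forall i, P i -> measurable_fun [set: X] (k i)) ->
  (forall i x, P i -> 0 <= k i x)%R ->
  (forall s : seq T, uniq s -> (forall i, i \in s -> P i) ->
    \int[mu]_x ((\sum_(i <- s) k i x) `^ q)%:E <= M) ->
  \int[mu]_x (\esum_(i in P) (k i x)%:E) `^ q <= M.
Proof.
move=> q0 mk k0 kM; have [s [us sP sa]] := @countable_exhaustion R _ t0 _ cP.
pose g n x : \bar R := \sum_(i <- s n) (k i x)%:E.
have g_ge0 n x : 0 <= g n x.
  by rewrite /g big_seq sume_ge0// => i /sP Pi; rewrite lee_fin k0.
have gx x : nondecreasing_seq (g ^~ x) /\ g n x @[n --> \oo] --> \esum_(i in P) (k i x)%:E.
  by apply: sa => i Pi; rewrite lee_fin k0.
have gE n x : g n x `^ q = ((\sum_(i <- s n) k i x) `^ q)%:E.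
  by rewrite /g sumEFin.
pose h n x := g n x `^ q.
have mh n : measurable_fun [set: X] (h n).
  rewrite /h; under eq_fun do rewrite gE; apply/measurable_EFinP.
  by apply: measurable_fun_powR; apply: measurable_sum_seq => i /sP; exact: mk.
have hnd x : nondecreasing_seq (h ^~ x).
  move=> m n mn; apply: gt0_ler_poweR; rewrite ?(ltW q0)//.
  - by rewrite in_itv/= g_ge0 leey.
  - by rewrite in_itv/= g_ge0 leey.
  - exact: (gx x).1.
have hcvg x : cvgn (h ^~ x) by exact: ereal_nondecreasing_is_cvgn.
have hM n : \int[mu]_x h n x <= M.
  under eq_integral do rewrite /h gE.
  by apply: kM => //; exact: sP.
have limM : \int[mu]_x limn (h ^~ x) <= M.
  rewrite monotone_convergence//; last by move=> n x _; exact: poweR_ge0.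
  apply: lime_le; last by apply: nearW.
  apply: ereal_nondecreasing_is_cvgn => m n mn; apply: ge0_le_integral => //.
  - by move=> x _; exact: poweR_ge0.
  - by move=> x _; exact: hnd.
apply: le_trans limM; apply: ge0_le_integral => //.
- by move=> x _; exact: poweR_ge0.
- apply: (@measurableT_comp _ _ _ _ _ _ (fun y : \bar R => y `^ q)).
    exact: measurable_poweR.
  apply: measurable_fun_esum => [i Pi|i x Pi]; last by rewrite lee_fin k0.
  by apply/measurable_EFinP; exact: mk.
- apply: (emeasurable_fun_cvg h) => // x _; exact: hcvg.
(* The power of the limit is at most the limit of the powers: take roots in
   [h n x <= limn (h ^~ x)] and let [n] go to infinity. *)
move=> x _; have hlim n : h n x <= limn (h ^~ x).
  rewrite (cvg_lim _ (ereal_nondecreasing_cvgn (hnd x)))//.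
  by apply: ereal_sup_ubound; exists n.
have h_ge0 : 0 <= limn (h ^~ x) by apply: (le_trans _ (hlim 0%N)); exact: poweR_ge0.
have e0 : 0 <= \esum_(i in P) (k i x)%:E by apply: esum_ge0 => i Pi; rewrite lee_fin k0.
have -> : limn (h ^~ x) = (limn (h ^~ x) `^ q^-1) `^ q.
  by rewrite -poweRrM mulVf ?gt_eqF// poweRe1.
apply: gt0_ler_poweR; rewrite ?(ltW q0)// ?in_itv/= ?leey ?andbT//.
  exact: poweR_ge0.
have [_ gcvg] := gx x.
rewrite -(cvg_lim _ gcvg)//; apply: lime_le; first by apply/cvg_ex; eexists; exact: gcvg.
apply: nearW => n.
have -> : g n x = h n x `^ q^-1 by rewrite -poweRrM mulfV ?gt_eqF// poweRe1.
apply: gt0_ler_poweR; rewrite ?invr_ge0 ?(ltW q0)// ?in_itv/= ?leey ?andbT//.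
exact: poweR_ge0.
Qed.

End esum_integral.

Section esum_compare.
Context {d} {X : measurableType d} {R : realType} {T : choiceType}.
Variables (mu : {measure set X -> \bar R}) (t0 : T) (P : set T) (q : R).
Hypotheses (cP : countable P) (q0 : 0 < q).
Local Open Scope ereal_scope.

Lemma poweR_esum_le (Q : set T) (a b : T -> \bar R) : P `<=` Q ->
  (forall i, P i -> 0 <= a i) -> (forall i, P i -> a i <= b i) ->
  (\esum_(i in P) a i) `^ q <= (\esum_(i in Q) b i) `^ q.
Proof.
move=> PQ a0 ab; have e0 : 0 <= \esum_(i in P) a i by exact: esum_ge0.
have eab := le_esum_subset PQ ab.
apply: gt0_ler_poweR => //; first exact: ltW.
- by rewrite in_itv/= e0 leey.
- by rewrite in_itv/= (le_trans e0 eab) leey.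
Qed.

Lemma measurable_poweR_esum (k : T -> X -> R) :
  (forall i, P i -> measurable_fun [set: X] (k i)) ->
  (forall i x, P i -> 0 <= k i x)%R ->
  measurable_fun [set: X] (fun x => (\esum_(i in P) (k i x)%:E) `^ q).
Proof.
move=> mk k0; apply: (@measurableT_comp _ _ _ _ _ _ (fun y : \bar R => y `^ q)).
  exact: measurable_poweR.
apply: (measurable_fun_esum t0 cP) => [i Pi|i x Pi]; last by rewrite lee_fin k0.
by apply/measurable_EFinP; exact: mk.
Qed.

Lemma integral_poweR_seq_le_esum (k : T -> X -> R) (E : seq T) :
  (forall i, P i -> measurable_fun [set: X] (k i)) ->
  (forall i x, P i -> 0 <= k i x)%R ->
  uniq E -> (forall i, i \in E -> P i) ->
  \int[mu]_x ((\sum_(i <- E) k i x) `^ q)%:E <=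
  \int[mu]_x (\esum_(i in P) (k i x)%:E) `^ q.
Proof.
move=> mk k0 uE EP; apply: ge0_le_integral => //.
- by move=> x _; rewrite lee_fin powR_ge0.
- apply/measurable_EFinP; apply: measurable_fun_powR.
  by apply: measurable_sum_seq => i /EP; exact: mk.
- exact: measurable_poweR_esum.
move=> x _; rewrite -poweR_EFin -sumEFin.
have sum_ge0 : 0 <= \sum_(i <- E) (k i x)%:E.
  by rewrite big_seq sume_ge0// => i /EP Pi; rewrite lee_fin k0.
have sum_le : \sum_(i <- E) (k i x)%:E <= \esum_(i in P) (k i x)%:E.
  by apply: esum_ge_seq => // i Pi; rewrite lee_fin k0.
apply: gt0_ler_poweR => //; first exact: ltW.
- by rewrite in_itv/= sum_ge0 leey.
- by rewrite in_itv/= (le_trans sum_ge0 sum_le) leey.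
Qed.

Lemma integral_poweR_esum_restrict (k : T -> X -> R) (J : set X) :
  (forall i x, P i -> ~ J x -> k i x = 0%R) ->
  \int[mu]_(x in J) (\esum_(i in P) (k i x)%:E) `^ q =
  \int[mu]_x (\esum_(i in P) (k i x)%:E) `^ q.
Proof.
move=> kJ; rewrite integral_mkcond; apply: eq_integral => x _.
rewrite patchE; case: ifPn => // xJ.
rewrite esum1 ?poweR0r ?gt_eqF// => i Pi; rewrite kJ// => Jx.
by move/negP: xJ; apply; exact: mem_set.
Qed.

End esum_compare.

(** * Stopping intervals and the Carleson embedding *)

Section stopping.
Context {X : Type} {R : realType}.
Implicit Types (s t : seq (set X)) (I J S T : set X).

Definition laminar (s : set (set X)) := forall I J, s I -> s J ->
  I `&` J !=set0 -> I `<=` J \/ J `<=` I.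

Lemma minimal_mem s : s != [::] ->
  exists2 S, S \in s & forall I, I \in s -> I `<=` S -> I = S.
Proof.
elim: s => // J s IH _; have [->|/IH[S Ss Smin]] := eqVneq s [::].
  by exists J; rewrite ?mem_head// => I; rewrite inE => /eqP.
have [JS|JS] := pselect (J `<=` S).
  exists J; rewrite ?mem_head// => I; rewrite inE => /predU1P[//|Is IJ].
  have IS := Smin _ Is (subset_trans IJ JS).
  by apply/seteqP; split => //; rewrite IS.
by exists S; rewrite ?inE ?Ss ?orbT// => I; rewrite inE => /predU1P[->|/Smin].
Qed.

(** Intervals are treated from the largest to the smallest: a minimal interval
    [M] is added last, and it is selected only if no interval selected before
    controls its mean. *)
Let exists_stopping s (a : set X -> R) : (forall I, 0 <= a I) ->
  exists t, [/\ uniq t, {subset t <= s},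
    forall S T, S \in t -> T \in t -> S `<=` T -> S != T -> 2 * a T < a S &
    forall I, I \in s -> exists S, [/\ S \in t, I `<=` S & a I <= 2 * a S]].
Proof.
move=> a0; have [n] := ubnP (size s); elim: n s => // n IH s.
rewrite ltnS => sn; have [->|/minimal_mem[M Ms Mmin]] := eqVneq s [::].
  by exists [::].
have [|t [ut ts tgrow tI]] := IH (rem M s).
  by rewrite (leq_trans _ sn)// size_rem// prednK// lt0n size_eq0; case: (s) Ms.
have {}ts S : S \in t -> S \in s by move=> /ts/mem_rem.
have mems I : I \in s -> I = M \/ I \in rem M s.
  by rewrite (perm_mem (perm_to_rem Ms)) inE => /predU1P.
have [[S [St MS aMS]]|noS] := pselect (exists S, [/\ S \in t, M `<=` S & a M <= 2 * a S]).
  exists t; split => // I /mems[->|/tI//]; by exists S.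
exists (M :: t); split => /=.
- rewrite ut andbT; apply/negP => Mt; apply: noS; exists M; split => //.
  by have := a0 M; lra.
- by move=> S; rewrite inE => /predU1P[->//|/ts].
- move=> S T; rewrite !inE => /predU1P[->|St] /predU1P[->|Tt].
  + by rewrite eqxx.
  + move=> MT _; rewrite ltNge; apply/negP => aMT; apply: noS.
    by exists T.
  + by move=> SM; rewrite (Mmin _ (ts _ St) SM) eqxx.
  + exact: tgrow.
- move=> I /mems[->|/tI[S [St IS aIS]]].
    by exists M; split; rewrite ?mem_head//; have := a0 M; lra.
  by exists S; rewrite inE St orbT.
Qed.

(** The doubling of the means is stated for any two stopping intervals that
    meet because [sum_geometric_growth] is applied to those around a point. The
    map [pi] sends an interval to the least stopping interval containing it; the
    control of the mean survives this choice because the means increase along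
    nested stopping intervals. *)
Lemma stopping_family s (a : set X -> R) :
  (forall I, I \in s -> I !=set0) -> laminar [set` s] -> (forall I, 0 <= a I) ->
  exists t (pi : set X -> set X), [/\ uniq t, {subset t <= s},
    forall S T, S \in t -> T \in t -> S `&` T !=set0 -> S != T ->
      2 * a S < a T \/ 2 * a T < a S &
    forall I, I \in s -> [/\ pi I \in t, I `<=` pi I, a I <= 2 * a (pi I) &
      forall T, T \in t -> I `<=` T -> pi I `<=` T]].
Proof.
move=> s0 lam a0; have [t [ut ts tgrow tI]] := exists_stopping s a0.
have piP I : exists S, I \in s -> [/\ S \in t, I `<=` S, a I <= 2 * a S &
      forall T, T \in t -> I `<=` T -> S `<=` T].
  have [Is|] := boolP (I \in s); last by exists I.
  have [S0 [S0t IS0 aIS0]] := tI _ Is.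
  have [S] : exists2 S, S \in [seq S <- t | `[< I `<=` S >]] &
      forall T, T \in [seq S <- t | `[< I `<=` S >]] -> T `<=` S -> T = S.
    apply: minimal_mem; apply/eqP => /(congr1 (fun u => S0 \in u)).
    by rewrite mem_filter S0t andbT in_nil => /asboolP; exact.
  rewrite mem_filter => /andP[/asboolP IS St] Smin.
  have Sleast T : T \in t -> I `<=` T -> S `<=` T.
    move=> Tt IT; have [i Ii] := s0 _ Is.
    have [//|TS] := lam _ _ (ts _ St) (ts _ Tt) (ex_intro _ i (conj (IS _ Ii) (IT _ Ii))).
    by rewrite (Smin T)// mem_filter Tt andbT; apply/asboolP.
  exists S => _; split => //; apply: (le_trans aIS0).
  have [->//|SS0] := eqVneq S S0.
  have := tgrow _ _ St S0t (Sleast _ S0t IS0) SS0.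
  by have := a0 S0; lra.
have [pi {}piP] := choice piP.
exists t, pi; split => // S T St Tt ST0 ST.
have [SsT|TsS] := lam _ _ (ts _ St) (ts _ Tt) ST0.
- by right; exact: tgrow.
- by left; apply: tgrow => //; rewrite eq_sym.
Qed.

End stopping.

Section carleson.
Context {d} {X : measurableType d} {R : realType}.
Variable mu : {measure set X -> \bar R}.

(** The Carleson sum is the integral of [f] against the sum of
    [a S `^ (q - 1)] over the stopping intervals around a point. At each point
    these values grow geometrically, so the q'-th power of their sum is at most a
    constant times the sum of the [a S `^ q], whose integral is the Carleson sum
    itself. Young's inequality with conjugate exponents q, q' then bounds the
    Carleson sum by the norm of [f] plus 1/q' times the Carleson sum, which is
    finite and can be absorbed. *)
Lemma carleson_stopping (q q' : R) (t : seq (set X)) (a : set X -> R) (f : X -> R) :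
  0 < q -> 0 < q' -> q^-1 + q'^-1 = 1 ->
  uniq t -> (forall S, S \in t -> measurable S) ->
  (forall S, S \in t -> (mu S < +oo)%E) -> (forall S, 0 <= a S) ->
  (forall S T, S \in t -> T \in t -> S `&` T !=set0 -> S != T ->
      2 * a S < a T \/ 2 * a T < a S) ->
  measurable_fun [set: X] f -> (forall x, 0 <= f x) ->
  (forall S, S \in t -> \int[mu]_(x in S) (f x)%:E = (a S)%:E * mu S)%E ->
  (\sum_(S <- t) (a S `^ q)%:E * mu S <=
    (carleson_constant q)%:E * \int[mu]_x (f x `^ q)%:E)%E.
Proof.
move=> q0 q'0 qq' ut mt fint a0 tgrow mf f0 aE.
have q1 := conjugate_gt1 q0 q'0 qq'.
have q10 : 0 < q - 1 by rewrite subr_gt0.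
have qM := conjugate_mul q0 q'0 qq'. rewrite /carleson_constant.
set K := geometric_bound (q - 1); have K0 : 0 < K by exact: geometric_bound_gt0.
pose psi x : R := \sum_(S <- t) a S `^ (q - 1) * \1_S x.
pose chi x : R := \sum_(S <- t) a S `^ q * \1_S x.
have chi0 x : 0 <= chi x by rewrite sumr_ge0// => S _; rewrite mulr_ge0// powR_ge0.
have psi0 x : 0 <= psi x by rewrite sumr_ge0// => S _; rewrite mulr_ge0// powR_ge0.
have psi_chi x : psi x `^ q' <= K `^ q' * chi x.
  rewrite -[X in _ * X](powRr1 (chi0 x)).
  have -> : 1 = (q^-1 * (q - 1)) * q' by rewrite -mulrA qM mulVf// gt_eqF.
  rewrite !powRrM -powRM ?powR_ge0//; last exact: ltW.
  apply: ler_powR2r => //; first exact: ltW.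
  rewrite /psi (bigID (fun S => x \in S))/= [X in _ + X]big1 ?addr0; last first.
    by move=> S /negPf xS; rewrite indicE xS mulr0.
  rewrite (eq_bigr (fun S => a S `^ (q - 1))); last first.
    by move=> S xS; rewrite indicE xS mulr1.
  rewrite -big_filter; apply: sum_geometric_growth => //.
  - exact: powR_ge0.
  - by rewrite filter_uniq.
  - move=> S; rewrite mem_filter => /andP[xS St].
    rewrite -[leLHS](powRr1 (a0 S)) -(mulfV (lt0r_neq0 q0)) powRrM.
    apply: ler_powR2r; rewrite ?invr_ge0 ?(ltW q0) ?powR_ge0//.
    rewrite /chi (perm_big _ (perm_to_rem St)) big_cons indicE xS mulr1 lerDl.
    by rewrite sumr_ge0// => T _; rewrite mulr_ge0// powR_ge0.
  - move=> S T; rewrite !mem_filter => /andP[xS St] /andP[xT Tt].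
    apply: tgrow => //; exists x; split; [exact: set_mem xS|exact: set_mem xT].
set Sg := (\sum_(S <- t) _)%E.
have SgE : Sg = (\int[mu]_x (chi x)%:E)%E.
  by rewrite integral_step// => S _; exact: powR_ge0.
have Sgfin : Sg \is a fin_num.
  rewrite /Sg big_seq; apply/sum_fin_numP => S St _.
  by rewrite fin_numM// ge0_fin_numE// fint.
have mpsi : measurable_fun [set: X] psi.
  by apply: measurable_sum_seq => S St; apply: measurable_indic_scale; exact: mt.
have mchi : measurable_fun [set: X] chi.
  by apply: measurable_sum_seq => S St; apply: measurable_indic_scale; exact: mt.
have SgE' : Sg = (\int[mu]_x (f x * psi x)%:E)%E.
  under eq_integral do rewrite mulr_sumr.
  rewrite integral_sum_seq; last 2 first.
  - move=> S St; apply: measurable_funM => //.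
    by apply: measurable_indic_scale; exact: mt.
  - by move=> S x St; rewrite !mulr_ge0// powR_ge0.
  rewrite /Sg big_seq [RHS]big_seq; apply: eq_bigr => S St.
  rewrite (eq_integral (fun x => (a S `^ (q - 1) * (f x * \1_S x))%:E)); last first.
    by move=> x _; rewrite mulrCA.
  rewrite integralZ_ge0 ?powR_ge0//; last 2 first.
  - by apply: measurable_funM => //; apply: measurable_indic; exact: mt.
  - by move=> x; rewrite mulr_ge0.
  rewrite integral_mul_indic; last exact: mt.
  by rewrite aE// muleA -EFinM mulrC mulr_powRB1.
set Iq := (\int[mu]_x (f x `^ q)%:E)%E.
(* Young's inequality for the product of [K * f] and [psi / K]: with this
   normalization the coefficient of [Sg] is exactly [q'^-1 < 1]. *)
have key : (Sg <= (K `^ q / q)%:E * Iq + (q'^-1)%:E * Sg)%E.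
  rewrite {1}SgE' [in leRHS]SgE -integralZ_ge0//; last 3 first.
  - by rewrite divr_ge0 ?powR_ge0// ltW.
  - exact: measurable_fun_powR.
  - by move=> x; exact: powR_ge0.
  rewrite -integralZ_ge0//; last by rewrite invr_ge0 ltW.
  rewrite -ge0_integralD//=; last 4 first.
  - by move=> x _; rewrite lee_fin mulr_ge0 ?powR_ge0// divr_ge0 ?powR_ge0// ltW.
  - by apply/measurable_EFinP; apply: measurable_funM => //; exact: measurable_fun_powR.
  - by move=> x _; rewrite lee_fin mulr_ge0// invr_ge0 ltW.
  - by apply/measurable_EFinP; apply: measurable_funM.
  apply: ge0_le_integral => //=.
  - by move=> x _; rewrite lee_fin mulr_ge0.
  - by apply/measurable_EFinP; apply: measurable_funM.
  - apply/measurable_EFinP; apply: measurable_funD; apply: measurable_funM => //.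
    exact: measurable_fun_powR.
  move=> x _; rewrite lee_fin.
  have -> : f x * psi x = (K * f x) * (psi x / K) by field; rewrite gt_eqF.
  apply: (le_trans (conjugate_powR _ _ q0 q'0 qq')).
  - by rewrite mulr_ge0// ltW.
  - by rewrite divr_ge0// ltW.
  rewrite powRM ?(ltW K0)// mulrAC lerD2l.
  have -> : (psi x / K) `^ q' = psi x `^ q' / K `^ q'.
    by rewrite powR_div// ltW.
  rewrite mulrC ler_wpM2l ?invr_ge0 ?(ltW q'0)//.
  by rewrite ler_pdivrMr ?powR_gt0// mulrC.
have Kq0 : 0 < K `^ q / q by rewrite divr_gt0 ?powR_gt0.
have [->|] := eqVneq Iq +oo%E.
  by rewrite gt0_muley ?leey// lte_fin powR_gt0.
rewrite -ltey => Ioo.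
have Ifin : Iq \is a fin_num.
  by rewrite ge0_fin_numE//; apply: integral_ge0 => x _; rewrite lee_fin powR_ge0.
move: key; rewrite -(fineK Sgfin) -(fineK Ifin) -!EFinM -EFinD !lee_fin.
have -> : q'^-1 = 1 - q^-1 by rewrite -qq'; ring.
set A := fine Sg; set B := fine Iq => H.
have {}H : A * q^-1 <= K `^ q * B * q^-1 by lra.
by rewrite ler_pM2r ?invr_gt0// in H.
Qed.

End carleson.

(** * Pairing two families of stopping intervals *)

Section pairing.
Context {d} {X : measurableType d} {R : realType}.
Local Open Scope ereal_scope.

Lemma sume_at_most_one (T : eqType) (s : seq T) (P : pred T) (w : \bar R) :
  uniq s -> (forall i j, P i -> P j -> i = j) -> 0 <= w ->
  \sum_(i <- s | P i) w <= w.
Proof.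
move=> us Puniq w0; elim: s us => [|i s IH]; first by rewrite big_nil.
move=> /= /andP[is_ us]; rewrite big_cons; case: ifPn => Pi; last exact: IH.
rewrite big_seq_cond big1 ?adde0// => j /andP[js Pj].
by move: is_; rewrite (Puniq _ _ Pi Pj) js.
Qed.

Lemma sume_partition (T U : eqType) (E : seq T) (F : T -> U) (s : seq U)
    (x : T -> \bar R) : uniq s -> (forall e, e \in E -> F e \in s) ->
  \sum_(e <- E) x e = \sum_(u <- s) \sum_(e <- E | F e == u) x e.
Proof.
move=> us Fs; rewrite (exchange_big_dep xpredT)//= big_seq [RHS]big_seq.
apply: eq_bigr => e eE; rewrite -big_filter.
suff -> : [seq u <- s | F e == u] = [:: F e] by rewrite big_seq1.
rewrite (eq_filter (a2 := pred1 (F e))); last by move=> u; rewrite /= eq_sym.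
by rewrite filter_pred1_uniq// Fs.
Qed.

(** Fix [S] and consider the indices [e] with [F e = S]. At a point of [Q e] the
    number [v (G e)] is at most the l^r' norm [W `^ r'^-1] of the family of all
    [v T], [T] running over the values of [G] in this group. This can be pulled out
    of the sum, the remaining factor is controlled in L^r by the testing
    hypothesis, and Young's inequality separates the two. Summing over [S], each
    [T] is counted once because [G e] determines [F e].

    The same lemma serves both testing conditions: in one case [Q e] is the
    child, in the other one it is the parent, and [sigma] and [tau] are
    exchanged. *)
Lemma corona_pairing (sigma tau : {measure set X -> \bar R}) (r r' D : R)
    (P : eqType) (E : seq P) (Q F G : P -> set X) (k : P -> R)
    (u v : set X -> R) (sF sG : seq (set X)) :
  (0 < D)%R ->
  (0 < r)%R -> (0 < r')%R -> (r^-1 + r'^-1 = 1)%R ->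
  uniq sF -> uniq sG ->
  (forall e, e \in E -> F e \in sF) -> (forall e, e \in E -> G e \in sG) ->
  (forall S, S \in sG -> measurable S) ->
  (forall e, e \in E -> measurable (Q e)) ->
  (forall e, e \in E -> Q e `<=` G e) ->
  (forall e, e \in E -> 0 <= k e)%R ->
  (forall S, 0 <= u S)%R -> (forall S, 0 <= v S)%R ->
  (forall e e', e \in E -> e' \in E -> G e = G e' -> F e = F e') ->
  (forall S, S \in sF ->
    \int[sigma]_x ((\sum_(e <- E | F e == S) k e * \1_(Q e) x) `^ r)%:E
    <= (D `^ r)%:E * tau S) ->
  \sum_(e <- E) (k e * (u (F e) * v (G e)))%:E * sigma (Q e) <=
  D%:E * (\sum_(S <- sF) (u S `^ r)%:E * tau S +
          \sum_(S <- sG) (v S `^ r')%:E * sigma S).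
Proof.
move=> D0 r0 r'0 rr' uF uG EF EG mG mQ QG k0 u0 v0 GF test.
pose K S T := has (fun e => (F e == S) && (G e == T)) E.
pose phi S x : R := (\sum_(e <- E | F e == S) k e * \1_(Q e) x)%R.
have phi0 S x : (0 <= phi S x)%R.
  by rewrite /phi big_seq_cond sumr_ge0// => e /andP[eE _]; rewrite mulr_ge0// k0.
have mphi S : measurable_fun [set: X] (phi S).
  by apply: measurable_sum_seq => e eE; apply: measurable_indic_scale; exact: mQ.
have corona S : S \in sF ->
    \sum_(e <- E | F e == S) (k e * (u (F e) * v (G e)))%:E * sigma (Q e) <=
    D%:E * ((u S `^ r)%:E * tau S +
            \sum_(T <- sG | K S T) (v T `^ r')%:E * sigma T).
  move=> SF; rewrite -integral_step//; last first.
    by move=> e eE; rewrite !mulr_ge0// k0.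
  pose W x : R := (\sum_(T <- sG | K S T) v T `^ r' * \1_T x)%R.
  have W0 x : (0 <= W x)%R by rewrite sumr_ge0// => T _; rewrite mulr_ge0// powR_ge0.
  have mW : measurable_fun [set: X] W.
    by apply: measurable_sum_seq => T TG; apply: measurable_indic_scale; exact: mG.
  pose c := (u S `^ r / D `^ r)%R.
  have c0 : (0 <= c)%R by rewrite divr_ge0// powR_ge0.
  apply: (@le_trans _ _ (\int[sigma]_x (D * (c * phi S x `^ r + W x))%:E)).
    apply: ge0_le_integral => //=.
    - move=> x _; rewrite lee_fin big_seq_cond sumr_ge0// => e /andP[eE _].
      by rewrite !mulr_ge0// k0.
    - apply/measurable_EFinP/measurable_sum_seq => e eE.
      by apply: measurable_indic_scale; exact: mQ.
    - apply/measurable_EFinP; apply: measurable_funM => //.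
      apply: measurable_funD => //; apply: measurable_funM => //.
      exact: measurable_fun_powR.
    move=> x _; rewrite lee_fin.
    apply: (@le_trans _ _ (u S * phi S x * W x `^ (r'^-1))%R).
      rewrite mulrAC mulr_sumr big_seq_cond [leRHS]big_seq_cond.
      apply: ler_sum => e /andP[eE /eqP FeS].
      rewrite FeS indicE; case: (boolP (x \in Q e)) => xQ; last by rewrite !mulr0.
      rewrite !mulr1 (mulrC (k e)) ler_wpM2r ?k0// ler_wpM2l//.
      rewrite -[leLHS](powRr1 (v0 _)) -(mulfV (lt0r_neq0 r'0)) powRrM.
      apply: ler_powR2r; rewrite ?invr_ge0 ?(ltW r'0) ?powR_ge0//.
      rewrite /W (perm_big _ (perm_to_rem (EG _ eE))) big_cons.
      rewrite ifT; last by apply/hasP; exists e => //; rewrite FeS !eqxx.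
      have -> : \1_(G e) x = 1%R :> R.
        by rewrite indicE mem_set//; apply: (QG _ eE); exact: set_mem xQ.
      rewrite mulr1 lerDl sumr_ge0// => T _.
      by rewrite mulr_ge0// powR_ge0.
    have -> : (u S * phi S x * W x `^ r'^-1 =
        D * ((u S * phi S x / D) * W x `^ r'^-1))%R by field; rewrite gt_eqF.
    rewrite ler_pM2l//.
    apply: (le_trans (young r0 r'0 rr' _ (powR_ge0 _ _))).
      by rewrite divr_ge0 ?mulr_ge0// ltW.
    rewrite -powRrM mulVf ?gt_eqF// powRr1// lerD2r.
    by rewrite powR_div ?(ltW D0) ?mulr_ge0// powRM// /c mulrAC.
  rewrite integralZ_ge0 ?(ltW D0)//; last 2 first.
  - apply: measurable_funD => //; apply: measurable_funM => //.
    exact: measurable_fun_powR.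
  - by move=> x; rewrite addr_ge0// mulr_ge0// powR_ge0.
  rewrite lee_pmul2l//.
  under eq_integral do rewrite EFinD.
  rewrite ge0_integralD//=; last 4 first.
  - by move=> x _; rewrite lee_fin mulr_ge0// powR_ge0.
  - apply/measurable_EFinP; apply: measurable_funM => //.
    exact: measurable_fun_powR.
  - by move=> x _; rewrite lee_fin.
  - exact/measurable_EFinP.
  rewrite integral_step//; last by move=> T _; exact: powR_ge0.
  apply: leeD => //; rewrite integralZ_ge0//; last 2 first.
  - exact: measurable_fun_powR.
  - by move=> x; exact: powR_ge0.
  apply: (@le_trans _ _ (c%:E * ((D `^ r)%:E * tau S))).
    by apply: lee_wpmul2l; rewrite ?lee_fin//; exact: test.
  rewrite muleA -EFinM /c -mulrA mulVf ?mulr1//.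
  by rewrite gt_eqF// powR_gt0.
rewrite (sume_partition _ uF EF).
apply: (@le_trans _ _ (\sum_(S <- sF) D%:E * ((u S `^ r)%:E * tau S +
            \sum_(T <- sG | K S T) (v T `^ r')%:E * sigma T))).
  by rewrite big_seq [leRHS]big_seq; apply: lee_sum => S; exact: corona.
rewrite -ge0_sume_distrr; last first.
  move=> S _; rewrite adde_ge0//; first by rewrite mule_ge0// lee_fin powR_ge0.
  by rewrite sume_ge0// => T _; rewrite mule_ge0// lee_fin powR_ge0.
rewrite lee_pmul2l// big_split/= leeD// (exchange_big_dep xpredT)//=.
apply: lee_sum => T _; apply: sume_at_most_one => //.
  move=> S S' /hasP[e eE /andP[/eqP <- /eqP eT]] /hasP[e' e'E /andP[/eqP <- /eqP e'T]].
  by apply: GF => //; rewrite eT e'T.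
by rewrite mule_ge0// lee_fin powR_ge0.
Qed.

End pairing.

(** * Parents and children in an atomic filtration *)

Section filtration.
Context {d} {X : measurableType d} {R : realType}.
Variables (mu : {measure set X -> \bar R}) (S L : int -> set (set X)).
Hypothesis hL : atomic_filtration mu S L.
Implicit Types I J : set X.

Definition parent_child_pairs : set (set X * set X) :=
  intervals L `*`` children (R := R) L.

Let filtration_le m n : m <= n -> S m `<=` S n.
Proof.
rewrite -subr_ge0 => mn; have -> : n = m + `|n - m|%:Z.
  by rewrite gez0_abs// subrKC.
elim: `|n - m|%N => [|k IH]; first by rewrite addr0.
apply: (subset_trans IH); rewrite -addn1 PoszD addrA.
exact: (filtration_increasing hL).
Qed.

Let atom_sub m n I J : L m I -> L n J -> m <= n -> I `&` J !=set0 -> J `<=` I.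
Proof.
move=> mI nJ mn [x [Ix Jx]].
have : S n I by apply: (filtration_le mn); exact: (atoms_in_filtration hL).
move=> /(atoms_generate hL)[F FL IE]; move: Ix; rewrite IE => -[K FK Kx].
have <- : K = J by apply: (atoms_disjoint hL (FL _ FK) nJ); exists x.
exact: bigcup_sup.
Qed.

Lemma interval_measurable I : intervals L I -> measurable I.
Proof.
by move=> [n _ nI]; apply: (filtration_measurable hL (n := n)); exact: (atoms_in_filtration hL).
Qed.

Lemma interval_nonempty I : intervals L I -> I !=set0.
Proof. by move=> [n _ nI]; exact: (atoms_nonempty hL nI). Qed.

Lemma intervals_laminar : laminar (intervals L).
Proof.
move=> I J [m _ mI] [n _ nJ] IJ; have [mn|nm] := leP m n.
  by right; exact: atom_sub mI nJ mn IJ.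
by left; apply: (atom_sub nJ mI (ltW nm)); rewrite setIC.
Qed.

Lemma intervals_countable : countable (intervals L).
Proof. by apply: bigcup_countable => // n _; exact: (atoms_countable hL). Qed.

Lemma child_interval I J : intervals L I -> children (R := R) L I J -> intervals L J.
Proof. by move=> LI [[n [_ nJ _]]|[_ ->//]]; exists (n + 1). Qed.

Lemma child_sub I J : children (R := R) L I J -> J `<=` I.
Proof. by move=> [[n []]//|[_ ->]]. Qed.

Lemma parent_child_pairs_countable : countable parent_child_pairs.
Proof.
apply: (@sub_countable _ _ _ (intervals L `*` intervals L)).
  by apply: subset_card_le => -[I J] /= [LI IJ]; split => //; exact: child_interval IJ.
by apply: countableX; exact: intervals_countable.
Qed.

Let rk_level n m I : rk (R := R) L I = (n%:~R)%:E -> L m I -> m <= n.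
Proof.
move=> rkI mI; rewrite -(ler_int R) -lee_fin -rkI.
by apply: ereal_sup_ubound; exists m.
Qed.

Let rk_attained n I : rk (R := R) L I = (n%:~R)%:E -> L n I.
Proof.
move=> rkI.
have : exists2 x : \bar R, [set (m%:~R)%:E | m in [set m | L m I]] x &
    (ereal_sup [set (m%:~R)%:E | m in [set m | L m I]] - 1%:E < x)%E.
  by apply: ub_ereal_sup_adherent => //; rewrite -/(rk L I) rkI.
rewrite -/(rk L I) rkI => -[_ [m mI <-]].
rewrite -EFinB lte_fin ltrBlDr -intrD1 ltr_int ltzD1 => nm.
by have := rk_level rkI mI => mn; have <- : m = n by apply/eqP; rewrite eq_le mn nm.
Qed.

Lemma children_disjoint I J J' : children (R := R) L I J ->
  children (R := R) L I J' -> J `&` J' !=set0 -> J = J'.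
Proof.
move=> [[n [rkI nJ _]]|[rkI ->]] [[m [rkI' mJ _]]|[rkI' ->]]//.
- move: rkI'; rewrite rkI => -[/intr_inj nm] JJ'.
  by move: nm mJ => <- mJ; exact: (atoms_disjoint hL nJ mJ).
- by rewrite rkI in rkI'.
- by rewrite rkI in rkI'.
Qed.

(** If [I] has finite rank n, an interval strictly inside [I] cannot belong to a
    level up to n, because the atoms of these levels that meet [I] contain it. So
    its level is at least that of the children. *)
Lemma sub_child I J K : intervals L I -> children (R := R) L I J ->
  intervals L K -> K `<=` I -> K <> I -> K `&` J !=set0 -> K `<=` J.
Proof.
move=> LI [[n [rkI nJ JI]]|[_ ->//]] [m _ mK] KI KnI [x [Kx Jx]].
apply: (atom_sub nJ mK); last by exists x.
rewrite lezD1 ltNge; apply/negP => mn; apply: KnI.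
apply/seteqP; split => //; apply: (atom_sub mK (rk_attained rkI) mn).
by exists x; split => //; exact: KI.
Qed.

(** Of two proper parents of [J] the smaller one would lie inside a child of the
    larger one that meets [J], that is, inside [J]. The hypotheses exclude an
    interval of infinite rank, which is its own child. *)
Lemma proper_parent_unique I I' J : intervals L I -> intervals L I' ->
  children (R := R) L I J -> children (R := R) L I' J -> I <> J -> I' <> J -> I = I'.
Proof.
move=> LI LI' IJ I'J InJ I'nJ.
have [x Jx] := interval_nonempty (child_interval LI IJ).
have JI := child_sub IJ; have JI' := child_sub I'J.
wlog II' : I I' LI LI' IJ I'J InJ I'nJ JI JI' / I `<=` I'.
  move=> wl; have [II'|I'I] := intervals_laminar LI LI' (ex_intro _ x (conj (JI _ Jx) (JI' _ Jx))).
    exact: wl.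
  by symmetry; apply: wl.
apply: contrapT => InI'; apply: InJ; apply/seteqP; split => //.
apply: (sub_child LI' I'J LI II' InI'); exists x; split => //; exact: JI.
Qed.

End filtration.

(** * Finite families: testing implies boundedness *)

Section finite_testing.
Context {d} {X : measurableType d} {R : realType}.
Variables (mu nu : {measure set X -> \bar R}) (L : int -> set (set X)).
Variable alpha : set X * set X -> R.

Definition finite_pairs (J : set X) (E : seq (set X * set X)) : Prop :=
  uniq E /\ forall e, e \in E ->
    [/\ parent_child_pairs (R := R) L e, e.1 `<=` J & mu e.1 != 0%E].

Definition finite_direct_testing (r D : R) : Prop :=
  forall J E, intervals L J -> finite_pairs J E ->
  (\int[nu]_x ((\sum_(e <- E) alpha e * \1_(e.2) x) `^ r)%:E
    <= (D `^ r)%:E * mu J)%E.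

(** The coefficient of [1_I] in the bracket of the dual testing condition that
    comes from one child of [I]; it vanishes when [mu I = 0]. *)
Definition dual_weight (e : set X * set X) : R :=
  alpha e * fine (nu e.2) / fine (mu e.1).

Definition finite_dual_testing (r' D : R) : Prop :=
  forall J E, intervals L J -> finite_pairs J E ->
  (\int[mu]_x ((\sum_(e <- E) dual_weight e * \1_(e.1) x) `^ r')%:E
    <= (D `^ r')%:E * nu J)%E.

End finite_testing.

Section sufficiency.
Context {d} {X : measurableType d} {R : realType}.
Variables (mu nu : {measure set X -> \bar R}) (S L : int -> set (set X)).
Hypothesis hL : atomic_filtration mu S L.
Hypotheses (muL : locally_finite L mu) (nuL : locally_finite L nu).
Variable alpha : set X * set X -> R.
Hypothesis alpha0 : forall e, 0 <= alpha e.
Variables (p r r' : R).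
Hypotheses (hp : 2 < p) (hr : r = p / 2) (hrr' : r^-1 + r'^-1 = 1).

Let p0 : 0 < p. Proof. by apply: lt_trans hp. Qed.
Let r1 : 1 < r. Proof. by rewrite hr ltr_pdivlMr// mul1r. Qed.
Let r0 : 0 < r. Proof. exact: lt_trans r1. Qed.
Let r'0 : 0 < r'. Proof. exact: conjugate_gt0 hrr'. Qed.

Variable D : R.
Hypothesis D0 : 0 < D.
Hypothesis direct : finite_direct_testing mu nu L alpha r D.
Hypothesis dual : finite_dual_testing mu nu L alpha r' D.

Section bilinear.
Variables (f g : X -> R).
Hypotheses (mf : measurable_fun [set: X] f) (f0 : forall x, 0 <= f x).
Hypotheses (mg : measurable_fun [set: X] g) (g0 : forall x, 0 <= g x).
Hypothesis floc : forall I, intervals L I -> (\int[mu]_(x in I) (f x)%:E < +oo)%E.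
Hypothesis gloc : forall I, intervals L I -> (\int[nu]_(x in I) (g x)%:E < +oo)%E.

Let a := mean mu f.
Let c := mean nu g.

(** The constant: the factor 8 comes from replacing [a I ^+ 2 * c I'] by the
    means over the stopping intervals, the factor 3 from the three classes of
    pairs. *)
Lemma bilinear_estimate (E : seq (set X * set X)) : uniq E ->
  (forall e, e \in E -> parent_child_pairs (R := R) L e /\ mu e.1 != 0%E) ->
  (\sum_(e <- E) (alpha e * (a e.1 ^+ 2 * c e.2))%:E * nu e.2 <=
  (24 * D)%:E * ((carleson_constant p)%:E * \int[mu]_x (f x `^ p)%:E +
                 (carleson_constant r')%:E * \int[nu]_x (g x `^ r')%:E))%E.
Proof.
move=> uE EP.
have a0 I : 0 <= a I by exact: mean_ge0.
have c0 I : 0 <= c I by exact: mean_ge0.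
pose s := [seq e.1 | e <- E] ++ [seq e.2 | e <- E].
have sL I : I \in s -> intervals L I.
  rewrite mem_cat => /orP[]/mapP[e /EP[[Le1 Le2] _] ->//].
  exact: child_interval Le2.
have s1 e : e \in E -> e.1 \in s by move=> eE; rewrite mem_cat map_f.
have s2 e : e \in E -> e.2 \in s by move=> eE; rewrite mem_cat map_f ?orbT.
have s0 I : I \in s -> I !=set0 by move=> /sL; exact: (interval_nonempty hL).
have slam : laminar [set` s].
  by move=> I J /sL LI /sL LJ; exact: (intervals_laminar hL).
have sub2 e : e \in E -> e.2 `<=` e.1 by move=> /EP[[_ eC] _]; exact: child_sub eC.
have [tF [piF [uF Fs Fgrow FP]]] := stopping_family s0 slam a0.
have [tG [piG [uG Gs Ggrow GP]]] := stopping_family s0 slam c0.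
have FL I : I \in tF -> intervals L I by move=> /Fs/sL.
have GL I : I \in tG -> intervals L I by move=> /Gs/sL.
have mL I : intervals L I -> measurable I by exact: (interval_measurable hL).
pose F (e : set X * set X) := piF e.1; pose G (e : set X * set X) := piG e.2.
have Ft (e : set X * set X) : e \in E -> F e \in tF by move=> /s1/FP[].
have Gt (e : set X * set X) : e \in E -> G e \in tG by move=> /s2/GP[].
have Fsub (e : set X * set X) : e \in E -> e.1 `<=` F e by move=> /s1/FP[].
have Gsub (e : set X * set X) : e \in E -> e.2 `<=` G e by move=> /s2/GP[].
have Fmin (e : set X * set X) (T : set X) : e \in E -> T \in tF -> e.1 `<=` T -> F e `<=` T.
  by move=> /s1/FP[_ _ _]; exact.
have Gmin (e : set X * set X) (T : set X) : e \in E -> T \in tG -> e.2 `<=` T -> G e `<=` T.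
  by move=> /s2/GP[_ _ _]; exact.
pose u I := a I ^+ 2.
have u0 I : 0 <= u I by rewrite sqr_ge0.
pose Sf := (\sum_(I <- tF) (u I `^ r)%:E * mu I)%E.
pose Sg := (\sum_(I <- tG) (c I `^ r')%:E * nu I)%E.
pose T (e : set X * set X) := ((alpha e * (u (F e) * c (G e)))%:E * nu e.2)%E.
have nu_fin (e : set X * set X) : e \in E -> nu e.2 \is a fin_num.
  by move=> /s2/sL Le; rewrite ge0_fin_numE// nuL.
(* When [G] determines [F], the direct condition is applied on each [F e]. *)
have caseF E' : uniq E' -> {subset E' <= E} ->
    (forall e e', e \in E' -> e' \in E' -> G e = G e' -> F e = F e') ->
    (\sum_(e <- E') T e <= D%:E * (Sf + Sg))%E.
  move=> uE' E'E GF; apply: corona_pairing => //.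
  - by move=> e /E'E/Ft.
  - by move=> e /E'E/Gt.
  - by move=> I /GL/mL.
  - by move=> e /E'E/s2/sL/mL.
  - by move=> e /E'E/Gsub.
  move=> J JF; rewrite (eq_integral (fun x =>
      ((\sum_(e <- [seq e <- E' | F e == J]) alpha e * \1_(e.2) x) `^ r)%:E)); last first.
    by move=> x _; rewrite big_filter.
  apply: direct; first exact: FL.
  split; first by rewrite filter_uniq.
  move=> e; rewrite mem_filter => /andP[/eqP <- /E'E eE].
  by have [eP e0] := EP _ eE; split => //; exact: Fsub.
(* When [F] determines [G], the dual condition is applied on each [G e], which
   has to contain the parent for this. *)
have caseG E' : uniq E' -> {subset E' <= E} ->
    (forall e, e \in E' -> e.1 `<=` G e) ->
    (forall e e', e \in E' -> e' \in E' -> F e = F e' -> G e = G e') ->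
    (\sum_(e <- E') T e <= D%:E * (Sf + Sg))%E.
  move=> uE' E'E EG FG.
  have -> : (\sum_(e <- E') T e = \sum_(e <- E')
      (dual_weight mu nu alpha e * (c (G e) * u (F e)))%:E * mu e.1)%E.
    rewrite big_seq [RHS]big_seq; apply: eq_bigr => e /E'E eE.
    have [[Le1 _] mue0] := EP _ eE.
    have mufin : mu e.1 \is a fin_num by rewrite ge0_fin_numE// muL.
    rewrite /T -(fineK (nu_fin _ eE)) -(fineK mufin) -!EFinM; congr _%:E.
    rewrite /dual_weight /=; field; by rewrite fine_eq0.
  rewrite addeC; apply: corona_pairing => //.
  - by rewrite addrC.
  - by move=> e /E'E/Gt.
  - by move=> e /E'E/Ft.
  - by move=> I /FL/mL.
  - by move=> e /E'E/s1/sL/mL.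
  - by move=> e /E'E/Fsub.
  - by move=> e eE'; rewrite divr_ge0 ?mulr_ge0 ?fine_ge0.
  move=> J JG; rewrite (eq_integral (fun x =>
      ((\sum_(e <- [seq e <- E' | G e == J])
          dual_weight mu nu alpha e * \1_(e.1) x) `^ r')%:E)); last first.
    by move=> x _; rewrite big_filter.
  apply: dual; first exact: GL.
  split; first by rewrite filter_uniq.
  move=> e; rewrite mem_filter => /andP[/eqP <- eE'].
  by have [eP e0] := EP _ (E'E _ eE'); split => //; exact: EG.
pose inG (e : set X * set X) := `[< e.1 `<=` G e >].
pose FinG (e : set X * set X) := `[< F e `<=` G e >].
have T0 e : (0 <= T e)%E.
  by apply: mule_ge0 => //; rewrite lee_fin (mulr_ge0 (alpha0 e) (mulr_ge0 (u0 _) (c0 _))).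
have total : (\sum_(e <- E) T e <= (3 * D)%:E * (Sf + Sg))%E.
  rewrite (bigID inG)/= [X in (X + _)%E](bigID FinG)/=.
  rewrite -(big_filter _ (fun i => inG i && FinG i)).
  rewrite -(big_filter _ (fun i => inG i && ~~ FinG i)).
  rewrite -(big_filter _ (fun i => ~~ inG i)).
  have -> : 3 * D = D + D + D by ring.
  rewrite !EFinD !ge0_muleDl ?lee_fin ?addr_ge0 ?(ltW D0)//.
  apply: leeD; first apply: leeD.
  (* [F e] inside [G e]: both [G e] and [G e'] are the least stopping interval
     containing [F e]. *)
  - apply: caseG; rewrite ?filter_uniq//.
    + by move=> e; rewrite mem_filter => /andP[].
    + by move=> e; rewrite mem_filter => /andP[/andP[/asboolP]].
    move=> e e'; rewrite !mem_filter => /andP[/andP[_ /asboolP FG] eE].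
    move=> /andP[/andP[_ /asboolP FG'] e'E] FF'; apply/seteqP; split.
    + apply: Gmin => //; first exact: Gt.
      apply: (subset_trans (sub2 _ eE)); apply: (subset_trans (Fsub _ eE)).
      by rewrite FF'.
    + apply: Gmin => //; first exact: Gt.
      apply: (subset_trans (sub2 _ e'E)); apply: (subset_trans (Fsub _ e'E)).
      by rewrite -FF'.
  (* [G e] inside [F e] and containing the parent: [F e] is the least stopping
     interval containing [G e]. *)
  - apply: caseF; rewrite ?filter_uniq//.
      by move=> e; rewrite mem_filter => /andP[].
    have GsubF e : e \in E -> e.1 `<=` G e -> ~ F e `<=` G e -> G e `<=` F e.
      move=> eE eG FG; have [x ex] := s0 _ (s1 _ eE).
      have GFx : G e `&` F e !=set0 by exists x; split; [exact: eG|exact: Fsub].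
      by case: (intervals_laminar hL (GL _ (Gt _ eE)) (FL _ (Ft _ eE)) GFx).
    move=> e e'; rewrite !mem_filter => /andP[/andP[/asboolP eG /asboolP FG] eE].
    move=> /andP[/andP[/asboolP eG' /asboolP FG'] e'E] GG'.
    apply/seteqP; split; apply: Fmin => //; try exact: Ft.
    + by apply: (subset_trans eG); rewrite GG'; exact: GsubF.
    + by apply: (subset_trans eG'); rewrite -GG'; exact: GsubF.
  (* [G e] strictly inside the parent: then it is the child, and it determines
     the parent. *)
  - apply: caseF; rewrite ?filter_uniq//.
      by move=> e; rewrite mem_filter => /andP[].
    have GE e : e \in E -> ~ e.1 `<=` G e -> G e = e.2 /\ e.1 <> e.2.
      move=> eE neG; have [x ex] := s0 _ (s2 _ eE).
      have [[Le1 Le2] _] := EP _ eE.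
      have Ge : G e `<=` e.1.
        have Gex : G e `&` e.1 !=set0 by exists x; split; [exact: Gsub|exact: sub2].
        by case: (intervals_laminar hL (GL _ (Gt _ eE)) Le1 Gex) => [|/neG].
      split; last by move=> e12; apply: neG; rewrite e12; exact: Gsub.
      apply/seteqP; split; last exact: Gsub.
      apply: (sub_child hL Le1 Le2) => //; first exact: GL (Gt _ eE).
      - by move=> Ge1; apply: neG; rewrite Ge1.
      - by exists x; split => //; exact: Gsub.
    move=> e e'; rewrite !mem_filter => /andP[/asboolP eG eE].
    move=> /andP[/asboolP eG' e'E] GG'.
    have [Ge e12] := GE _ eE eG; have [Ge' e'12] := GE _ e'E eG'.
    have ee' : e.2 = e'.2 by rewrite -Ge -Ge'.
    have [[Le1 Le2] _] := EP _ eE; have [[Le'1 Le'2] _] := EP _ e'E.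
    rewrite /F; congr piF; apply: (proper_parent_unique hL Le1 Le'1 Le2).
    + by rewrite ee'.
    + exact: e12.
    + by rewrite ee'.
apply: (@le_trans _ _ (8%:E * \sum_(e <- E) T e)%E).
  rewrite ge0_sume_distrr// big_seq [leRHS]big_seq; apply: lee_sum => e eE.
  rewrite /T muleA -EFinM lee_wpmul2r// lee_fin.
  have [_ _ aF _] := FP _ (s1 _ eE); have [_ _ cG _] := GP _ (s2 _ eE).
  have : a e.1 ^+ 2 * c e.2 <= (2 * a (F e)) ^+ 2 * (2 * c (G e)).
    apply: ler_pM => //; first exact: sqr_ge0.
    rewrite ler_sqr; first exact: aF.
    - by rewrite nnegrE.
    - by rewrite nnegrE (mulr_ge0 (ler0n _ 2) (a0 _)).
  rewrite -/(F e) -/(G e) mulrCA => /(ler_wpM2l (alpha0 e))/le_trans; apply.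
  by rewrite le_eqVlt /u; apply/orP; left; apply/eqP; ring.
have -> : 24 * D = 8 * (3 * D) by ring.
rewrite EFinM -muleA lee_pmul2l//.
apply: (le_trans total); rewrite lee_pmul2l//; last by rewrite lte_fin mulr_gt0.
have p1 : 1 < p by apply: lt_trans hp; rewrite ltr1n.
have pc : p^-1 + (1 - p^-1)^-1^-1 = 1 by rewrite invrK; ring.
have p'0 : 0 < (1 - p^-1)^-1 by rewrite invr_gt0 subr_gt0 invf_lt1.
apply: leeD.
- rewrite /Sf (eq_bigr (fun I => (a I `^ p)%:E * mu I)%E); last first.
    move=> I _; congr (_%:E * _)%E.
    by rewrite /u -powR_mulrn// -powRrM hr; congr (_ `^ _); field.
  apply: (carleson_stopping p0 p'0 pc) => //.
  + by move=> I /FL/mL.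
  + by move=> I /FL/muL.
  + by move=> I /FL IL; rewrite integral_mean ?muL ?floc//; exact: mL.
- have rc : r'^-1 + r^-1 = 1 by rewrite addrC.
  apply: (carleson_stopping r'0 r0 rc) => //.
  + by move=> I /GL/mL.
  + by move=> I /GL/nuL.
  + by move=> I /GL IL; rewrite integral_mean ?nuL ?gloc//; exact: mL.
Qed.

End bilinear.

Definition sufficiency_constant : R :=
  48 * (carleson_constant p + carleson_constant r').

(** Apply [bilinear_estimate] with [g = s * h `^ (r - 1)], where [h] is the sum on
    the left. Its left-hand side becomes [s] times the integral [H] of [h `^ r],
    while the last term on the right is a multiple of [s `^ r' * H]; the scale
    [s] is chosen so that this term is at most half of [s * H]. *)
Lemma finite_sufficiency (f : X -> R) (E : seq (set X * set X)) :
  measurable_fun [set: X] f -> (forall x, 0 <= f x) ->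
  (forall I, intervals L I -> (\int[mu]_(x in I) (f x)%:E < +oo)%E) ->
  uniq E ->
  (forall e, e \in E -> parent_child_pairs (R := R) L e /\ mu e.1 != 0%E) ->
  (\int[nu]_x ((\sum_(e <- E) alpha e * mean mu f e.1 ^+ 2 * \1_(e.2) x) `^ r)%:E
   <= ((sufficiency_constant * D) `^ r)%:E * \int[mu]_x (f x `^ p)%:E)%E.
Proof.
move=> mf f0 floc uE EP.
pose k (e : set X * set X) := alpha e * mean mu f e.1 ^+ 2.
have k0 e : 0 <= k e by rewrite mulr_ge0// sqr_ge0.
pose h x : R := \sum_(e <- E) k e * \1_(e.2) x.
have EL e : e \in E -> intervals L e.2.
  by move=> /EP[[Le1 Le2] _]; exact: child_interval Le2.
have mE e : e \in E -> measurable e.2.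
  by move=> /EL; exact: (interval_measurable hL).
have h0 x : 0 <= h x by rewrite sumr_ge0// => e _; rewrite mulr_ge0.
have mh : measurable_fun [set: X] h.
  by apply: measurable_sum_seq => e eE; apply: measurable_indic_scale; exact: mE.
pose b := \sum_(e <- E) k e.
have hb x : h x <= b.
  by apply: ler_sum => e _; rewrite ler_piMr// indicE lern1 leq_b1.
have r10 : 0 < r - 1 by rewrite subr_gt0.
have rM : (r - 1) * r' = r by exact: conjugate_mul.
set H := (\int[nu]_x (h x `^ r)%:E)%E.
have H0 : (0 <= H)%E by apply: integral_ge0 => x _; rewrite lee_fin powR_ge0.
have Hfin : H \is a fin_num.
  rewrite ge0_fin_numE//; apply: step_powR_integral_lty => //; first exact: ltW.
  by move=> e eE; apply: nuL; exact: EL.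
have [k1 [k2 [c [Z [[k10 k20 c0 Z0] -> ZE est]]]]] :
    exists k1 k2 c Z : R, [/\ [/\ 0 <= k1, 0 <= k2, 0 <= c & 0 < Z],
    sufficiency_constant * D = Z, Z = 2 * (c * (k1 + k2)) &
    forall g : X -> R, measurable_fun [set: X] g -> (forall x, 0 <= g x) ->
    (forall I, intervals L I -> (\int[nu]_(x in I) (g x)%:E < +oo)%E) ->
    (\sum_(e <- E) (alpha e * (mean mu f e.1 ^+ 2 * mean nu g e.2))%:E * nu e.2 <=
     c%:E * (k1%:E * \int[mu]_x (f x `^ p)%:E + k2%:E * \int[nu]_x (g x `^ r')%:E))%E].
  have := fun g mg g0 gloc => @bilinear_estimate f g mf f0 mg g0 floc gloc E uE EP.
  have : 0 < carleson_constant p.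
    by apply: carleson_constant_gt0; apply: lt_trans hp; rewrite ltr1n.
  have : 0 < carleson_constant r'.
    by apply: carleson_constant_gt0; apply: (conjugate_gt1 r'0 r0); rewrite addrC.
  rewrite /sufficiency_constant.
  move: (carleson_constant p) (carleson_constant r') => k1 k2 k20 k10 est.
  exists k1, k2, (24 * D), (48 * (k1 + k2) * D); split=> //; last by ring.
  split; [exact: ltW|exact: ltW|by rewrite mulr_ge0// ltW|].
  by rewrite !mulr_gt0// addr_gt0.
set P := (\int[mu]_x (f x `^ p)%:E)%E.
have P0 : (0 <= P)%E by apply: integral_ge0 => x _; rewrite lee_fin powR_ge0.
have [->|] := eqVneq P +oo%E.
  by rewrite gt0_muley ?leey// lte_fin powR_gt0.
rewrite -ltey => Poo; have Pfin : P \is a fin_num by rewrite ge0_fin_numE.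
pose s := Z `^ (- (r - 1)).
have s0 : 0 < s by rewrite powR_gt0.
pose g x := s * h x `^ (r - 1).
have g0 x : 0 <= g x by rewrite mulr_ge0 ?powR_ge0// ltW.
have mg : measurable_fun [set: X] g.
  by apply: measurable_funM => //; exact: measurable_fun_powR.
have gb x : g x <= s * b `^ (r - 1).
  by rewrite ler_wpM2l ?(ltW s0)// ler_powR2r ?(ltW r10).
have gloc I : intervals L I -> (\int[nu]_(x in I) (g x)%:E < +oo)%E.
  move=> IL; apply: bounded_integral_lty gb => //; last exact: nuL.
  exact: (interval_measurable hL).
have := est g mg g0 gloc.
have -> : (\sum_(e <- E) (alpha e * (mean mu f e.1 ^+ 2 * mean nu g e.2))%:E * nu e.2 =
    s%:E * H)%E.
  transitivity (\sum_(e <- E) (\int[nu]_x (k e * (g x * \1_(e.2) x))%:E))%E.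
    rewrite big_seq [RHS]big_seq; apply: eq_bigr => e eE; have mEe := mE _ eE.
    rewrite integralZ_ge0//; last 2 first.
    - by apply: measurable_funM => //; exact: measurable_indic.
    - by move=> x; rewrite mulr_ge0.
    rewrite integral_mul_indic// integral_mean//; last 2 first.
    - by apply: nuL; exact: EL.
    - by apply: gloc; exact: EL.
    by rewrite muleA -EFinM mulrA.
  rewrite -integral_sum_seq; last 2 first.
  - move=> e eE; have mEe := mE _ eE; apply: measurable_funM => //.
    by apply: measurable_funM => //; exact: measurable_indic.
  - by move=> e x eE; apply: mulr_ge0 (k0 e) (mulr_ge0 (g0 x) _).
  rewrite -integralZ_ge0 ?(ltW s0)//; last 2 first.
  - exact: measurable_fun_powR.
  - by move=> x; exact: powR_ge0.
  apply: eq_integral => x _; congr _%:E.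
  transitivity (g x * h x).
    by rewrite mulr_sumr; apply: eq_bigr => e _; rewrite mulrCA.
  by rewrite /g -(mulr_powRB1 (h0 x) r0); ring.
have -> : (\int[nu]_x (g x `^ r')%:E = (Z `^ (- r))%:E * H)%E.
  rewrite -integralZ_ge0 ?powR_ge0//; last 2 first.
  - exact: measurable_fun_powR.
  - by move=> x; exact: powR_ge0.
  apply: eq_integral => x _; congr _%:E.
  by rewrite powRM ?powR_ge0// /s -!powRrM mulNr rM.
have -> : (\int[mu]_x (f x `^ p)%:E)%E = P by [].
rewrite -(fineK Hfin) -(fineK Pfin) -!EFinM !lee_fin.
have {}P0 : 0 <= fine P by exact: fine_ge0.
have {}H0 : 0 <= fine H by exact: fine_ge0.
exact: rescaled_absorption.
Qed.

End sufficiency.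

(** * Finite families: boundedness implies dual testing *)

Section necessity.
Context {d} {X : measurableType d} {R : realType}.
Variables (mu nu : {measure set X -> \bar R}) (S L : int -> set (set X)).
Hypothesis hL : atomic_filtration mu S L.
Hypotheses (muL : locally_finite L mu) (nuL : locally_finite L nu).
Variable alpha : set X * set X -> R.
Hypothesis alpha0 : forall e, 0 <= alpha e.
Variables (p r r' : R).
Hypotheses (hp : 2 < p) (hr : r = p / 2) (hrr' : r^-1 + r'^-1 = 1).

Let p0 : 0 < p. Proof. by apply: lt_trans hp. Qed.
Let r1 : 1 < r. Proof. by rewrite hr ltr_pdivlMr// mul1r. Qed.
Let r0 : 0 < r. Proof. exact: lt_trans r1. Qed.
Let r'0 : 0 < r'. Proof. exact: conjugate_gt0 hrr'. Qed.

Definition finite_paraproduct_bound (A : R) : Prop :=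
  forall (f : X -> R) (E : seq (set X * set X)),
  measurable_fun [set: X] f -> (forall x, 0 <= f x) ->
  (\int[mu]_x (f x `^ p)%:E < +oo)%E -> uniq E ->
  (forall e, e \in E -> parent_child_pairs (R := R) L e /\ mu e.1 != 0%E) ->
  (\int[nu]_x ((\sum_(e <- E) alpha e * mean mu f e.1 ^+ 2 * \1_(e.2) x) `^ r)%:E
   <= (A `^ p)%:E * \int[mu]_x (f x `^ p)%:E)%E.

Definition necessity_constant : R :=
  (2 * (2 * (2 `^ r * carleson_constant r)) `^ (r' - 1)) `^ r'^-1.

(** Here [f ^+ 2] is comparable with the maximal function of [h] over the family
    [s]: it is the l^r norm of the stopping means containing a point, doubled, so
    it dominates the mean of [h] over each [I] at all points of [I], and its
    L^r norm is a Carleson sum. The mean of a function bounded below by the square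
    root of a number on [I] is at least this square root. *)
Lemma maximal_square_root (s : seq (set X)) (h : X -> R) :
  (forall I, I \in s -> intervals L I) ->
  (forall I, I \in s -> mu I != 0%E) ->
  measurable_fun [set: X] h -> (forall x, 0 <= h x) ->
  (forall I, intervals L I -> (\int[mu]_(x in I) (h x)%:E < +oo)%E) ->
  exists f : X -> R, [/\ measurable_fun [set: X] f, forall x, 0 <= f x,
    (\int[mu]_x (f x `^ p)%:E < +oo)%E,
    (\int[mu]_x (f x `^ p)%:E <=
      (2 `^ r * carleson_constant r)%:E * \int[mu]_x (h x `^ r)%:E)%E &
    forall I, I \in s -> mean mu h I <= mean mu f I ^+ 2].
Proof.
move=> sL smu mh h0 hloc; pose a := mean mu h.
have a0 I : 0 <= a I by exact: mean_ge0.
have s0 I : I \in s -> I !=set0 by move=> /sL; exact: (interval_nonempty hL).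
have slam : laminar [set` s].
  by move=> I J /sL LI /sL LJ; exact: (intervals_laminar hL).
have [t [pi [ut ts tgrow tP]]] := stopping_family s0 slam a0.
have tL I : I \in t -> intervals L I by move=> /ts/sL.
have mL I : intervals L I -> measurable I by exact: (interval_measurable hL).
pose M x : R := \sum_(I <- t) (2 * a I) `^ r * \1_I x.
have M0 x : 0 <= M x by rewrite sumr_ge0// => I _; rewrite mulr_ge0 ?powR_ge0.
have mM : measurable_fun [set: X] M.
  by apply: measurable_sum_seq => I /tL/mL mI; exact: measurable_indic_scale.
pose f x := M x `^ p^-1.
have fpE : (\int[mu]_x (f x `^ p)%:E = \sum_(I <- t) ((2 * a I) `^ r)%:E * mu I)%E.
  rewrite -integral_step; last 2 first.
  - by move=> I /tL/mL.
  - by move=> I _; exact: powR_ge0.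
  apply: eq_integral => x _; congr _%:E.
  by rewrite /f -powRrM mulVf ?gt_eqF// powRr1.
have fge I x : I \in s -> I x -> a I `^ 2^-1 <= f x.
  move=> Is Ix; have [pit Ipi aI _] := tP _ Is.
  have -> : 2^-1 = r * p^-1 by rewrite hr; field; rewrite gt_eqF.
  rewrite powRrM; apply: ler_powR2r; rewrite ?powR_ge0 ?invr_ge0 ?(ltW p0)//.
  apply: (@le_trans _ _ ((2 * a (pi I)) `^ r)).
    by apply: ler_powR2r; rewrite ?(ltW r0).
  rewrite /M (perm_big _ (perm_to_rem pit)) big_cons indicE mem_set; last exact: Ipi.
  by rewrite mulr1 lerDl sumr_ge0// => J _; rewrite mulr_ge0 ?powR_ge0.
exists f; split.
- exact: measurable_fun_powR.
- by move=> x; exact: powR_ge0.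
- rewrite fpE big_seq; apply/lte_sum_pinfty => I /tL/muL muI.
  by rewrite lte_mul_pinfty ?lee_fin ?powR_ge0.
- rewrite fpE (eq_bigr (fun I => (2 `^ r)%:E * ((a I `^ r)%:E * mu I))%E); last first.
    by move=> I _; rewrite powRM// muleA EFinM.
  rewrite -ge0_sume_distrr; last first.
    by move=> I _; rewrite mule_ge0// lee_fin powR_ge0.
  rewrite EFinM -muleA lee_wpmul2l ?lee_fin ?powR_ge0//.
  apply: (carleson_stopping r0 r'0 hrr') => //.
  + by move=> I /tL/mL.
  + by move=> I /tL/muL.
  + by move=> I /tL IL; apply: integral_mean => //; [exact: mL|exact: muL|exact: hloc].
move=> I Is; have mI := mL _ (sL _ Is); have muI := muL (sL _ Is).
have Ifin : mu I \is a fin_num by rewrite ge0_fin_numE.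
have Ipos : 0 < fine (mu I).
  by rewrite fine_gt0// muI andbT lt0e smu ?measure_ge0.
have foo : (\int[mu]_(x in I) (f x)%:E < +oo)%E.
  apply: (@bounded_integral_lty _ _ _ mu f I ((\sum_(I <- t) (2 * a I) `^ r) `^ p^-1)) => //.
  - exact: measurable_fun_powR.
  - by move=> x; exact: powR_ge0.
  move=> x; apply: ler_powR2r; rewrite ?invr_ge0 ?(ltW p0)//.
  by apply: ler_sum => J _; rewrite ler_piMr ?powR_ge0// indicE lern1 leq_b1.
have : a I `^ 2^-1 <= mean mu f I.
  rewrite /mean ler_pdivlMr// -lee_fin EFinM fineK// fineK; last first.
    rewrite ge0_fin_numE//; apply: integral_ge0 => x _.
    by rewrite lee_fin powR_ge0.
  rewrite -(integral_cst mu mI); apply: ge0_le_integral => //.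
  - by move=> x _; rewrite lee_fin powR_ge0.
  - apply/measurable_EFinP; apply: (@measurable_funS _ _ _ _ setT) => //.
    exact: measurable_fun_powR.
  - by move=> x Ix; rewrite lee_fin fge.
rewrite -(@ler_pXn2r _ 2%N)// ?nnegrE ?powR_ge0 ?mean_ge0//; last first.
  by move=> x; exact: powR_ge0.
by rewrite -(powR_mulrn 2 (powR_ge0 _ _)) -powRrM mulVf// powRr1.
Qed.

(** Let [h] be the sum to be estimated and [H] the integral of [h `^ r'], that is,
    the pairing of [h] with [g = h `^ (r' - 1)]. Written out, [H] is the sum of
    [alpha e * nu e.2] times the mean of [g] over [e.1]. These means are at most
    the squared means of the function [f] given by [maximal_square_root], so [H]
    is at most the integral of [phi] over [J]. Young's inequality and the bound
    for [f] give a small multiple of [H] plus a multiple of [nu J]. *)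
Lemma finite_dual_necessity (A : R) : 0 < A -> finite_paraproduct_bound A ->
  finite_dual_testing mu nu L alpha r' (necessity_constant * A ^+ 2).
Proof.
move=> A0 bound J E LJ [uE EJ].
have r'1 : 1 < r' by apply: (conjugate_gt1 r'0 r0); rewrite addrC.
have r'10 : 0 < r' - 1 by rewrite subr_gt0.
have rM : (r' - 1) * r = r' by apply: conjugate_mul => //; rewrite addrC.
have EP e : e \in E -> parent_child_pairs (R := R) L e /\ mu e.1 != 0%E.
  by move=> /EJ[].
have EL1 e : e \in E -> intervals L e.1 by move=> /EP[[]].
have EL2 e : e \in E -> intervals L e.2.
  by move=> /EP[[Le1 Le2] _]; exact: child_interval Le2.
have m1 e : e \in E -> measurable e.1 by move=> /EL1; exact: (interval_measurable hL).
have m2 e : e \in E -> measurable e.2 by move=> /EL2; exact: (interval_measurable hL).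
pose w := dual_weight mu nu alpha.
have w0 e : 0 <= w e.
  by apply: divr_ge0; [apply: mulr_ge0 => //; exact: fine_ge0|exact: fine_ge0].
pose h x : R := \sum_(e <- E) w e * \1_(e.1) x.
have h0 x : 0 <= h x by rewrite sumr_ge0// => e _; apply: mulr_ge0 (w0 e) _.
have mh : measurable_fun [set: X] h.
  by apply: measurable_sum_seq => e eE; apply: measurable_indic_scale; exact: m1.
set H := (\int[mu]_x (h x `^ r')%:E)%E.
have H0 : (0 <= H)%E by apply: integral_ge0 => x _; rewrite lee_fin powR_ge0.
have Hfin : H \is a fin_num.
  rewrite ge0_fin_numE//; apply: step_powR_integral_lty => //; first exact: ltW.
  by move=> e eE; apply: muL; exact: EL1.
pose g x := h x `^ (r' - 1).
have g0 x : 0 <= g x by exact: powR_ge0.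
have mg : measurable_fun [set: X] g by exact: measurable_fun_powR.
have gloc I : intervals L I -> (\int[mu]_(x in I) (g x)%:E < +oo)%E.
  move=> IL; apply: (@bounded_integral_lty _ _ _ mu g I ((\sum_(e <- E) w e) `^ (r' - 1))) => //.
  - exact: (interval_measurable hL).
  - exact: muL.
  move=> x; apply: ler_powR2r; rewrite ?(ltW r'10)//.
  by apply: ler_sum => e _; rewrite ler_piMr// indicE lern1 leq_b1.
have [||f [mf f0 foo fH fmean]] :=
    @maximal_square_root [seq e.1 | e <- E] g _ _ mg g0 gloc.
- by move=> I /mapP[e /EL1 + ->].
- by move=> I /mapP[e /EP[_ +] ->].
pose k (e : set X * set X) := alpha e * mean mu f e.1 ^+ 2.
have k0 e : 0 <= k e by apply: mulr_ge0 (alpha0 e) (sqr_ge0 _).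
pose phi x : R := \sum_(e <- E) k e * \1_(e.2) x.
have phi0 x : 0 <= phi x by rewrite sumr_ge0// => e _; apply: mulr_ge0 (k0 e) _.
have mphi : measurable_fun [set: X] phi.
  by apply: measurable_sum_seq => e eE; apply: measurable_indic_scale; exact: m2.
have H_phi : (H <= \int[nu]_x (phi x)%:E)%E.
  have -> : H = (\sum_(e <- E) (alpha e * mean mu g e.1)%:E * nu e.2)%E.
    transitivity (\sum_(e <- E) (\int[mu]_x (w e * (g x * \1_(e.1) x))%:E))%E.
      rewrite -integral_sum_seq; last 2 first.
      - move=> e eE; have me := m1 _ eE; apply: measurable_funM => //.
        by apply: measurable_funM => //; exact: measurable_indic.
      - by move=> e x eE; apply: mulr_ge0 (w0 e) (mulr_ge0 (g0 x) _).
      apply: eq_integral => x _; congr _%:E.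
      rewrite -(mulr_powRB1 (h0 x) r'0) mulr_suml; apply: eq_bigr => e _.
      by rewrite -mulrA [_ * g x]mulrC.
    rewrite big_seq [RHS]big_seq; apply: eq_bigr => e eE; have me := m1 _ eE.
    rewrite integralZ_ge0//; last 2 first.
    - by apply: measurable_funM => //; exact: measurable_indic.
    - by move=> x; apply: mulr_ge0 (g0 x) _.
    rewrite (integral_mul_indic _ _ me).
    rewrite (integral_mean me (muL (EL1 _ eE)) mg g0 (gloc _ (EL1 _ eE))).
    have mufin : mu e.1 \is a fin_num by rewrite ge0_fin_numE// muL//; exact: EL1.
    have nufin : nu e.2 \is a fin_num by rewrite ge0_fin_numE// nuL//; exact: EL2.
    rewrite -(fineK nufin) -(fineK mufin) -!EFinM; congr _%:E.
    rewrite /w /dual_weight; field.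
    by rewrite fine_eq0//; have [] := EP _ eE.
  rewrite integral_step//.
  rewrite big_seq [leRHS]big_seq; apply: lee_sum => e eE.
  rewrite lee_wpmul2r// lee_fin ler_wpM2l// fmean//.
  by apply/mapP; exists e.
have phiJ x : phi x = phi x * \1_J x.
  rewrite indicE; case: (boolP (x \in J)) => xJ; first by rewrite mulr1.
  rewrite mulr0 /phi big_seq big1// => e eE; rewrite indicE.
  case: (boolP (x \in e.2)) => xe; rewrite ?mulr0//.
  exfalso; move/negP: xJ; apply; apply: mem_set.
  have [[_ eC] eJ _] := EJ _ eE; apply: eJ; apply: (child_sub eC).
  exact: set_mem xe.
have mJ : measurable J by exact: (interval_measurable hL).
have nuJ : nu J \is a fin_num by rewrite ge0_fin_numE// nuL.
have [C' C'0 C'E] : exists2 C' : R, 0 < C' & 2 `^ r * carleson_constant r = C'.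
  exists (2 `^ r * carleson_constant r) => //.
  by apply: mulr_gt0; [exact: powR_gt0|exact: carleson_constant_gt0].
rewrite C'E in fH.
pose Z := 2 * C' * A `^ p.
have Z0 : 0 < Z by apply: mulr_gt0 (mulr_gt0 _ C'0) (powR_gt0 _ A0).
(* The scale at which the multiple of [H] becomes one half. *)
pose eps := Z `^ (- r^-1).
have eps0 : 0 < eps by rewrite powR_gt0.
have epsr : eps `^ r = Z^-1.
  by rewrite -powRrM mulNr mulVf ?gt_eqF// powRN powRr1 ?ltW.
have epsr' : eps^-1 `^ r' = Z `^ (r' - 1).
  rewrite -powRN opprK -powRrM; congr (_ `^ _).
  have -> : r^-1 = 1 - r'^-1 by rewrite -hrr'; ring.
  by field; rewrite gt_eqF.
have young_phi : (\int[nu]_x (phi x)%:E <=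
    (eps `^ r)%:E * \int[nu]_x (phi x `^ r)%:E + (eps^-1 `^ r')%:E * nu J)%E.
  rewrite -(integral_indic1 nu mJ) -!integralZ_ge0 ?powR_ge0//; last 2 first.
  - exact: measurable_fun_powR.
  - by move=> x; exact: powR_ge0.
  rewrite -ge0_integralD//=; last 4 first.
  - by move=> x _; rewrite lee_fin mulr_ge0 ?powR_ge0.
  - by apply/measurable_EFinP; apply: measurable_funM => //; exact: measurable_fun_powR.
  - by move=> x _; rewrite lee_fin mulr_ge0 ?powR_ge0.
  - by apply/measurable_EFinP; exact: measurable_indic_scale.
  apply: ge0_le_integral => //.
  - by move=> x _; rewrite lee_fin.
  - exact/measurable_EFinP.
  - apply/measurable_EFinP; apply: measurable_funD.
      by apply: measurable_funM => //; exact: measurable_fun_powR.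
    exact: measurable_indic_scale.
  move=> x _; rewrite lee_fin [leLHS]phiJ.
  have -> : phi x * \1_J x = (eps * phi x) * (eps^-1 * \1_J x).
    by field; rewrite gt_eqF.
  apply: (le_trans (young r0 r'0 hrr' _ _)).
  - exact: mulr_ge0 (ltW eps0) (phi0 x).
  - by rewrite mulr_ge0// invr_ge0 ltW.
  rewrite !powRM ?invr_ge0 ?(ltW eps0)// lerD2l.
  rewrite indicE; case: (x \in J); first by rewrite powR1.
  by rewrite powR0 ?gt_eqF.
have H_le : (H <= (eps `^ r * A `^ p * C')%:E * H + (eps^-1 `^ r')%:E * nu J)%E.
  apply: (le_trans H_phi); apply: (le_trans young_phi); apply: leeD; last exact: lexx.
  rewrite -mulrA EFinM -muleA; apply: lee_wpmul2l; first by rewrite lee_fin powR_ge0.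
  apply: (le_trans (bound _ _ mf f0 foo uE EP)).
  rewrite EFinM -muleA; apply: lee_wpmul2l; first by rewrite lee_fin powR_ge0.
  apply: (le_trans fH); apply: lee_wpmul2l; first by rewrite lee_fin ltW.
  rewrite le_eqVlt; apply/orP; left; apply/eqP; apply: eq_integral => x _.
  by rewrite /g -powRrM rM.
have half : eps `^ r * A `^ p * C' = 2^-1.
  rewrite epsr /Z; field; rewrite !gt_eqF ?powR_gt0//.
have ApE : (A `^ p) `^ (r' - 1) = (A ^+ 2) `^ r'.
  rewrite -(powR_mulrn 2 (ltW A0)) -!powRrM; congr (_ `^ _).
  have -> : p = 2 * r by rewrite hr; field.
  by rewrite -mulrA [r * _]mulrC rM.
have ZE : Z `^ (r' - 1) = (2 * C') `^ (r' - 1) * (A ^+ 2) `^ r'.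
  by rewrite -ApE -powRM// ?powR_ge0// mulr_ge0// ltW.
have -> : (necessity_constant * A ^+ 2) `^ r' = 2 * eps^-1 `^ r'.
  rewrite epsr' ZE mulrA powRM ?sqr_ge0 ?powR_ge0//; congr (_ * _).
  rewrite /necessity_constant C'E -powRrM (mulVf (lt0r_neq0 r'0)) powRr1; first by [].
  exact: mulr_ge0 (ler0n _ 2) (powR_ge0 _ _).
rewrite -/H; move: H_le; rewrite half -(fineK Hfin) -(fineK nuJ) -!EFinM !lee_fin.
by rewrite -mulrA; exact: half_absorption.
Qed.

End necessity.

(** * The norm and the testing conditions as sums over pairs *)

Section reformulation.
Context {d} {X : measurableType d} {R : realType}.
Variables (mu nu : {measure set X -> \bar R}) (S L : int -> set (set X)).
Hypothesis hL : atomic_filtration mu S L.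
Hypotheses (muL : locally_finite L mu) (nuL : locally_finite L nu).
Variable beta : set X -> set X -> R.

Definition beta_sqr (e : set X * set X) : R := beta e.1 e.2 ^+ 2.

Local Notation alpha := beta_sqr.
Local Notation pairs := (parent_child_pairs (R := R) L).
Local Notation weight := (dual_weight mu nu alpha).

Definition pairs_below (J : set X) := [set e | pairs e /\ e.1 `<=` J].
Definition charged_pairs_below (J : set X) :=
  [set e | [/\ pairs e, e.1 `<=` J & mu e.1 != 0%E]].

Lemma beta_sqr_ge0 e : 0 <= alpha e.
Proof. exact: sqr_ge0. Qed.

Lemma weight_ge0 e : 0 <= weight e.
Proof.
by apply: divr_ge0; [apply: mulr_ge0 (beta_sqr_ge0 e) _|]; exact: fine_ge0.
Qed.

(** At most one child contains [x], so the square of the sum is the sum of the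
    squares. *)
Lemma b_fun_sqr I x : (`|b_fun L beta I x| ^+ 2)%:E =
  \esum_(I' in children (R := R) L I) (alpha (I, I') * \1_I' x)%:E.
Proof.
have [[J [IJ Jx]]|nJ] := pselect (exists J, children (R := R) L I J /\ J x).
  rewrite (esum_supported1 IJ); last 2 first.
  - by rewrite lee_fin mulr_ge0// beta_sqr_ge0.
  - move=> K IK KJ; rewrite indicE; case: (boolP (x \in K)) => xK; last by rewrite mulr0.
    exfalso; apply: KJ; apply: (children_disjoint hL IK IJ).
    by exists x; split => //; exact: set_mem xK.
  rewrite /b_fun -(@fsbig_widen _ _ _ _ [set J]); last 2 first.
  - by move=> _ ->.
  - move=> K [IK /= KJ]; rewrite indicE; case: (boolP (x \in K)) => xK; last by rewrite mulr0.
    exfalso; apply: KJ; apply: (children_disjoint hL IK IJ).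
    by exists x; split => //; exact: set_mem xK.
  by rewrite fsbig_set1 real_normK ?num_real// /beta_sqr/= indicE mem_set// !mulr1.
rewrite /b_fun fsbig1 ?normr0 ?expr0n/= ?esum1// => K IK; rewrite indicE.
  case: (boolP (x \in K)) => xK; last by rewrite mulr0.
  by exfalso; apply: nJ; exists K; split => //; exact: set_mem xK.
case: (boolP (x \in K)) => xK; last by rewrite mulr0.
by exfalso; apply: nJ; exists K; split => //; exact: set_mem xK.
Qed.

Lemma direct_sum_pairs J x :
  \esum_(I in [set I | subintervals L J I /\ mu I != 0%E])
    (`|b_fun L beta I x| ^+ 2)%:E =
  \esum_(e in charged_pairs_below J) (alpha e * \1_(e.2) x)%:E.
Proof.
rewrite (eq_esum (b := fun I => \esum_(I' in children (R := R) L I)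
    (alpha (I, I') * \1_I' x)%:E)); last by move=> I _; exact: b_fun_sqr.
rewrite esum_esum; last by move=> I I' _ _; rewrite lee_fin mulr_ge0// beta_sqr_ge0.
have -> : charged_pairs_below J =
    [set I | subintervals L J I /\ mu I != 0%E] `*`` children (R := R) L.
  by apply/seteqP; split => [[I I'] [[? ?] ? ?]|[I I'] [[[? ?] ?] ?]].
by apply: eq_esum => -[].
Qed.

Lemma child_measurable I I' : intervals L I -> children (R := R) L I I' ->
  measurable I'.
Proof. by move=> LI IC; apply: (interval_measurable hL); exact: child_interval IC. Qed.

Lemma children_countable I : intervals L I -> countable (children (R := R) L I).
Proof.
move=> LI; apply: sub_countable (intervals_countable hL).
by apply: subset_card_le => J; exact: child_interval.
Qed.

(** The factor [nu I] cancels against the one in the average. If [nu I = 0] both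
    sides vanish, as the children are null sets too. *)
Lemma dual_term_pairs I x : intervals L I ->
  ((fine (nu I) / fine (mu I))%:E *
     cond_exp nu I (fun y => (`|b_fun L beta I y| ^+ 2)%:E) x)%E =
  \esum_(I' in children (R := R) L I) (weight (I, I') * \1_I x)%:E.
Proof.
move=> LI; have mI := interval_measurable hL LI.
have nuI : nu I \is a fin_num by rewrite ge0_fin_numE// nuL.
have nu_child I' : children (R := R) L I I' -> nu I' \is a fin_num.
  by move=> IC; rewrite ge0_fin_numE// nuL//; exact: child_interval IC.
rewrite /cond_exp /average; case: ifPn => [/eqP nuI0|nuI0].
  rewrite mul0e mule0 esum1// => I' IC; rewrite /dual_weight/=.
  suff -> : nu I' = 0%E by rewrite mulr0 !mul0r.
  apply/eqP; rewrite eq_le measure_ge0 andbT -nuI0 le_measure ?inE//.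
    exact: child_measurable IC.
  exact: child_sub IC.
have nuI_neq0 : fine (nu I) != 0 by rewrite fine_eq0.
have -> : (\int[nu]_(y in I) (`|b_fun L beta I y| ^+ 2)%:E =
    \esum_(I' in children (R := R) L I) ((alpha (I, I'))%:E * nu I'))%E.
  rewrite integral_mkcond.
  rewrite (eq_integral (fun y => \esum_(I' in children (R := R) L I)
     (alpha (I, I') * \1_I' y)%:E)); last first.
    move=> y _; rewrite patchE; case: ifPn => yI; first exact: b_fun_sqr.
    rewrite esum1// => I' IC; rewrite indicE.
    case: (boolP (y \in I')) => yI'; last by rewrite mulr0.
    exfalso; move/negP: yI; apply; apply: mem_set; apply: (child_sub IC).
    exact: set_mem yI'.
  rewrite (integral_esum nu I (children_countable LI)); last 2 first.
  - by move=> I' IC; apply: measurable_indic_scale; exact: child_measurable IC.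
  - by move=> I' y IC; rewrite mulr_ge0// beta_sqr_ge0.
  apply: eq_esum => I' IC; have mI' := child_measurable LI IC.
  by rewrite integralZ_ge0 ?integral_indic1//; exact: beta_sqr_ge0.
set total := esum _ _.
rewrite (muleAC _ total) -EFinM muleA -EFinM.
have -> : fine (nu I) / fine (mu I) * ((fine (nu I))^-1 * \1_I x) =
    (fine (mu I))^-1 * \1_I x by rewrite mulrACA mulfV// mul1r.
rewrite /total esumZl; last 2 first.
- by rewrite mulr_ge0// invr_ge0 fine_ge0.
- by move=> I' IC; rewrite mule_ge0// lee_fin beta_sqr_ge0.
apply: eq_esum => I' IC; rewrite -(fineK (nu_child _ IC)) -!EFinM; congr _%:E.
by rewrite /dual_weight /=; ring.
Qed.

Lemma dual_sum_pairs J x :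
  \esum_(I in subintervals L J)
    ((fine (nu I) / fine (mu I))%:E *
       cond_exp nu I (fun y => (`|b_fun L beta I y| ^+ 2)%:E) x)%E =
  \esum_(e in pairs_below J) (weight e * \1_(e.1) x)%:E.
Proof.
rewrite (eq_esum (b := fun I => \esum_(I' in children (R := R) L I)
    (weight (I, I') * \1_I x)%:E)); last by move=> I [LI _]; exact: dual_term_pairs.
rewrite esum_esum; last by move=> I I' _ _; rewrite lee_fin mulr_ge0// weight_ge0.
have -> : pairs_below J = subintervals L J `*`` children (R := R) L.
  by apply/seteqP; split => [[I I'] [[? ?] ?]|[I I'] [[? ?] ?]].
by apply: eq_esum => -[].
Qed.

Section paraproduct_norm.
Variable p : R.
Hypothesis p1 : 1 <= p.
Let p0 : 0 < p. Proof. exact: lt_le_trans p1. Qed.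

Variable f : X -> R.
Hypotheses (mf : measurable_fun [set: X] f)
           (foo : (\int[mu]_x (`|f x| `^ p)%:E < +oo)%E).

(** [`|f x|] is at most [1 + `|f x| `^ p], and [I] has finite measure. *)
Lemma abs_integral_lty I : intervals L I ->
  (\int[mu]_(x in I) (`|f x|)%:E < +oo)%E.
Proof.
move=> LI; have mI := interval_measurable hL LI.
have mabs : measurable_fun [set: X] (fun x => `|f x|) by exact: measurableT_comp.
rewrite -integral_mul_indic//.
apply: (@le_lt_trans _ _ (\int[mu]_x (\1_I x + `|f x| `^ p)%:E)%E).
  apply: ge0_le_integral => //=.
  - by apply/measurable_EFinP; apply: measurable_funM => //; exact: measurable_indic.
  - apply/measurable_EFinP; apply: measurable_funD; first exact: measurable_indic.
    exact: measurable_fun_powR.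
  move=> x _; rewrite lee_fin indicE; case: (x \in I); last first.
    by rewrite mulr0 add0r powR_ge0.
  rewrite mulr1; have [f1|/ltW f1] := leP `|f x| 1.
    by rewrite (le_trans f1)// lerDl powR_ge0.
  apply: (@le_trans _ _ (`|f x| `^ p)); last by rewrite lerDr.
  by rewrite -[leLHS]powRr1// ler_powR.
under eq_integral do rewrite EFinD.
rewrite ge0_integralD//=; last 2 first.
- by apply/measurable_EFinP; exact: measurable_indic.
- by apply/measurable_EFinP; exact: measurable_fun_powR.
by rewrite integral_indic1// lte_add_pinfty// muL.
Qed.

Definition signed_mean I : R := fine (average mu I (EFin \o f)).

Let integral_fin I : intervals L I ->
  (\int[mu]_(x in I) (f x)%:E)%E \is a fin_num.
Proof.
move=> LI; apply: integrable_fin_num; first exact: (interval_measurable hL).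
apply/integrableP; split; last exact: abs_integral_lty.
by apply/measurable_EFinP; exact: measurable_funS mf.
Qed.

Lemma average_signed_mean I : intervals L I ->
  average mu I (EFin \o f) = (signed_mean I)%:E.
Proof.
move=> LI; rewrite /signed_mean fineK// /average; case: ifPn => // _.
by rewrite fin_numM// integral_fin.
Qed.

Lemma signed_mean0 I : mu I = 0%E -> signed_mean I = 0.
Proof. by move=> I0; rewrite /signed_mean /average I0 eqxx. Qed.

Lemma signed_mean_ge0E I : (forall x, 0 <= f x) -> intervals L I -> mu I != 0%E ->
  signed_mean I = mean mu f I.
Proof.
move=> f0 LI I0; rewrite /signed_mean /average (negPf I0) /mean.
by rewrite fineM ?integral_fin//= mulrC.
Qed.

Lemma signed_mean_le I : intervals L I -> mu I != 0%E ->
  signed_mean I ^+ 2 <= mean mu (fun x => `|f x|) I ^+ 2.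
Proof.
move=> LI I0; have mI := interval_measurable hL LI.
rewrite -ler_sqrt; last by rewrite sqr_ge0.
rewrite !sqrtr_sqr [leRHS]ger0_norm ?mean_ge0//.
rewrite /signed_mean /average (negPf I0) /mean fineM ?integral_fin//= mulrC normrM.
rewrite [X in _ * X]ger0_norm ?invr_ge0 ?fine_ge0// ler_wpM2r ?invr_ge0 ?fine_ge0//.
rewrite -lee_fin -abse_EFin !fineK ?integral_fin//; last first.
  by rewrite ge0_fin_numE ?abs_integral_lty//; exact: integral_ge0.
apply: le_abse_integral => //.
by apply/measurable_EFinP; exact: measurable_funS mf.
Qed.

Lemma TLnorm_paraproduct :
  (TLnorm L nu p (paraproduct mu beta f) `^ p =
   \int[nu]_x (\esum_(e in pairs)
     (alpha e * signed_mean e.1 ^+ 2 * \1_(e.2) x)%:E) `^ (p / 2))%E.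
Proof.
rewrite /TLnorm poweR_Lnorm ?gt_eqF//; apply: eq_integral => x _.
rewrite gee0_abs ?poweR_ge0// -poweRrM [in LHS]mulrC; congr (_ `^ _)%E.
rewrite (eq_esum (b := fun I => \esum_(I' in children (R := R) L I)
   (alpha (I, I') * signed_mean I ^+ 2 * \1_I' x)%:E)); last first.
  move=> I LI; apply: eq_esum => I' IC.
  rewrite /paraproduct average_signed_mean// -EFinM; congr _%:E.
  rewrite -normrM ger0_norm; last by rewrite -expr2 sqr_ge0.
  by rewrite /beta_sqr /=; ring.
rewrite esum_esum; first by apply: eq_esum => -[].
move=> I I' _ _; rewrite lee_fin.
by apply: mulr_ge0 (mulr_ge0 (beta_sqr_ge0 _) (sqr_ge0 _)) _.
Qed.

End paraproduct_norm.

End reformulation.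

(** * From finite families to all intervals *)

Section conditions.
Context {d} {X : measurableType d} {R : realType}.
Variables (mu nu : {measure set X -> \bar R}) (S L : int -> set (set X)).
Hypothesis hL : atomic_filtration mu S L.
Hypotheses (muL : locally_finite L mu) (nuL : locally_finite L nu).
Variables (p r r' : R).
Hypotheses (hp : 2 < p) (hr : r = p / 2) (hrr' : r^-1 + r'^-1 = 1).
Variable beta : set X -> set X -> R.

Local Notation alpha := (beta_sqr beta).
Local Notation pairs := (parent_child_pairs (R := R) L).
Local Notation weight := (dual_weight mu nu alpha).
Local Notation t0 := (set0 : set X, set0 : set X).

Let p0 : 0 < p. Proof. by apply: lt_trans hp. Qed.
Let p1 : 1 <= p. Proof. by apply: ltW; apply: lt_trans hp; rewrite ltr1n. Qed.
Let r1 : 1 < r. Proof. by rewrite hr ltr_pdivlMr// mul1r. Qed.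
Let r0 : 0 < r. Proof. exact: lt_trans r1. Qed.
Let r'0 : 0 < r'. Proof. exact: conjugate_gt0 hrr'. Qed.

Let powp (x : R) : 0 <= x -> (x ^+ 2) `^ r = x `^ p.
Proof.
by move=> x0; rewrite -powR_mulrn// -powRrM hr; congr (_ `^ _); field.
Qed.

Let pairs_sub P : P `<=` pairs -> countable P.
Proof.
move=> Pp; apply: sub_countable (parent_child_pairs_countable hL).
exact: subset_card_le.
Qed.

Let below_sub J : pairs_below (R := R) L J `<=` pairs.
Proof. by move=> e []. Qed.

Let charged_sub J : charged_pairs_below mu L J `<=` pairs.
Proof. by move=> e []. Qed.

Let m1 e : pairs e -> measurable e.1.
Proof. by move=> [Le1 _]; exact: (interval_measurable hL). Qed.

Let m2 e : pairs e -> measurable e.2.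
Proof. by move=> [Le1 eC]; exact: (child_measurable hL Le1 eC). Qed.

Lemma direct_testingE B : direct_testing L mu nu p beta B <->
  forall J, intervals L J ->
    (\int[nu]_x (\esum_(e in charged_pairs_below mu L J) (alpha e * \1_(e.2) x)%:E) `^ r
      <= (B `^ p)%:E * mu J)%E.
Proof.
have eqJ J : (\int[nu]_(x in J) (\esum_(I in [set I | subintervals L J I /\ mu I != 0%E])
      (`|b_fun L beta I x| ^+ 2)%:E) `^ (p / 2) =
    \int[nu]_x (\esum_(e in charged_pairs_below mu L J) (alpha e * \1_(e.2) x)%:E) `^ r)%E.
  rewrite -(integral_poweR_esum_restrict nu r0 (J := J)); last first.
    move=> e x [[_ eC] eJ _] nJx; rewrite indicE memNset ?mulr0// => ex.
    by apply: nJx; apply: eJ; exact: (child_sub eC).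
  by rewrite hr; apply: eq_integral => x _; rewrite (direct_sum_pairs hL).
by split => H J LJ; have := H J LJ; rewrite eqJ.
Qed.

Lemma dual_testingE Bs : dual_testing L mu nu r' beta Bs <->
  forall J, intervals L J ->
    (\int[mu]_x (\esum_(e in pairs_below (R := R) L J) (weight e * \1_(e.1) x)%:E) `^ r'
      <= (Bs `^ r')%:E * nu J)%E.
Proof.
have eqJ J : (\int[mu]_(x in J) (\esum_(I in subintervals L J)
    ((fine (nu I) / fine (mu I))%:E *
       cond_exp nu I (fun y => (`|b_fun L beta I y| ^+ 2)%:E) x)) `^ r' =
    \int[mu]_x (\esum_(e in pairs_below (R := R) L J) (weight e * \1_(e.1) x)%:E) `^ r')%E.
  rewrite -(integral_poweR_esum_restrict mu r'0 (J := J)); last first.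
    move=> e x [_ eJ] nJx; rewrite indicE memNset ?mulr0// => ex.
    by apply: nJx; exact: eJ.
  by apply: eq_integral => x _; rewrite (dual_sum_pairs hL nuL).
by split => H J LJ; have := H J LJ; rewrite eqJ.
Qed.

Let Lnorm_powerE (f : X -> R) :
  ('N[mu]_p%:E[EFin \o f] `^ p = \int[mu]_x (`|f x| `^ p)%:E)%E.
Proof. by rewrite poweR_Lnorm ?gt_eqF. Qed.

Let LfunP (f : X -> R) : f \in Lfun mu p%:E <->
  measurable_fun [set: X] f /\ (\int[mu]_x (`|f x| `^ p)%:E < +oo)%E.
Proof.
rewrite -Lnorm_powerE; split.
  move=> /andP[]; rewrite !inE => mf foo; split => //.
  exact: poweR_lty.
move=> [mf foo]; apply/andP; rewrite !inE; split => //.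
by apply: lty_poweRy foo; rewrite gt_eqF.
Qed.

Lemma paraproduct_boundE A : paraproduct_bound L mu nu p beta A <->
  forall f : X -> R, measurable_fun [set: X] f ->
    (\int[mu]_x (`|f x| `^ p)%:E < +oo)%E ->
    (\int[nu]_x (\esum_(e in pairs)
       (alpha e * signed_mean mu f e.1 ^+ 2 * \1_(e.2) x)%:E) `^ r
     <= (A `^ p)%:E * \int[mu]_x (`|f x| `^ p)%:E)%E.
Proof.
split => H f.
  move=> mf foo; have := H f; rewrite (TLnorm_paraproduct nu hL muL beta p1 mf foo) Lnorm_powerE hr.
  by apply; apply/LfunP.
move=> /LfunP[mf foo]; rewrite (TLnorm_paraproduct nu hL muL beta p1 mf foo).
by rewrite Lnorm_powerE -hr; exact: H.
Qed.

(** The exponents match because [B `^ p] is [(B ^+ 2) `^ r]. *)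
Lemma direct_testing_finite B D : 0 <= B -> B ^+ 2 <= D ->
  direct_testing L mu nu p beta B -> finite_direct_testing mu nu L alpha r D.
Proof.
move=> B0 BD /direct_testingE dir J E LJ [uE EJ].
apply: (@le_trans _ _ ((B `^ p)%:E * mu J)%E); last first.
  rewrite lee_wpmul2r// lee_fin -powp//; apply: ler_powR2r => //; first exact: ltW.
  exact: sqr_ge0.
apply: le_trans (dir _ LJ).
apply: (integral_poweR_seq_le_esum nu t0 (pairs_sub (@charged_sub J)) r0
  (k := fun e x => alpha e * \1_(e.2) x)) => //.
- by move=> e /charged_sub/m2 me; exact: measurable_indic_scale.
- by move=> e x _; rewrite mulr_ge0// beta_sqr_ge0.
Qed.

Lemma dual_testing_finite Bs D : 0 <= Bs -> Bs <= D ->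
  dual_testing L mu nu r' beta Bs -> finite_dual_testing mu nu L alpha r' D.
Proof.
move=> Bs0 BD /dual_testingE dual J E LJ [uE EJ].
apply: (@le_trans _ _ ((Bs `^ r')%:E * nu J)%E); last first.
  by rewrite lee_wpmul2r// lee_fin; apply: ler_powR2r => //; exact: ltW.
apply: le_trans (dual _ LJ).
apply: (integral_poweR_seq_le_esum mu t0 (pairs_sub (@below_sub J)) r'0
  (k := fun e x => weight e * \1_(e.1) x)) => //.
- by move=> e /below_sub/m1 me; exact: measurable_indic_scale.
- by move=> e x _; rewrite mulr_ge0// weight_ge0.
- by move=> e /EJ[].
Qed.

Lemma finite_testing_dual Bs : finite_dual_testing mu nu L alpha r' Bs ->
  dual_testing L mu nu r' beta Bs.
Proof.
move=> fin; apply/dual_testingE => J LJ.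
apply: (integral_esum_poweR_le t0) => //.
- exact: pairs_sub (@below_sub J).
- by move=> e /below_sub/m1 me; exact: measurable_indic_scale.
- by move=> e x _; rewrite mulr_ge0// weight_ge0.
move=> E uE EJ; pose E' := [seq e <- E | mu e.1 != 0%E].
rewrite (eq_integral (fun x => ((\sum_(e <- E') weight e * \1_(e.1) x) `^ r')%:E)).
  apply: fin => //; split; first by rewrite filter_uniq.
  by move=> e; rewrite mem_filter => /andP[e0 /EJ[]].
move=> x _; rewrite big_filter [in LHS](bigID (fun e => mu e.1 != 0%E))/=.
rewrite [X in _ + X]big1 ?addr0// => e; rewrite negbK => /eqP e0.
by rewrite /dual_weight e0/= invr0 mulr0 mul0r.
Qed.

Lemma paraproduct_bound_finite A : paraproduct_bound L mu nu p beta A ->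
  finite_paraproduct_bound mu nu L alpha p r A.
Proof.
move=> /paraproduct_boundE bound f E mf f0 foo uE EP.
have fE : (\int[mu]_x (f x `^ p)%:E = \int[mu]_x (`|f x| `^ p)%:E)%E.
  by apply: eq_integral => x _; rewrite ger0_norm.
rewrite fE in foo *; apply: le_trans (bound f mf foo).
pose k e x := alpha e * signed_mean mu f e.1 ^+ 2 * \1_(e.2) x.
rewrite (eq_integral (fun x => ((\sum_(e <- E) k e x) `^ r)%:E)); last first.
  move=> x _; congr (_ `^ _)%:E; rewrite big_seq [RHS]big_seq; apply: eq_bigr => e eE.
  have [[Le1 _] e0] := EP _ eE.
  by rewrite /k (signed_mean_ge0E hL muL p1 mf foo).
apply: (integral_poweR_seq_le_esum nu t0 (parent_child_pairs_countable hL) r0 (k := k)) => //.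
- by move=> e /m2 me; exact: measurable_indic_scale.
- by move=> e x _; apply: mulr_ge0 (mulr_ge0 (beta_sqr_ge0 _ _) (sqr_ge0 _)) _.
- by move=> e /EP[].
Qed.

(** Take [f = 1_J]: its mean is 1 over each interval in [J] of positive measure. *)
Lemma paraproduct_bound_direct A : paraproduct_bound L mu nu p beta A ->
  direct_testing L mu nu p beta A.
Proof.
move=> /paraproduct_boundE bound; apply/direct_testingE => J LJ.
have mJ := interval_measurable hL LJ.
have indE : (\int[mu]_x (`|\1_J x : R| `^ p)%:E = mu J)%E.
  rewrite -(integral_indic1 mu mJ); apply: eq_integral => x _.
  rewrite indicE; case: (x \in J); first by rewrite normr1 powR1.
  by rewrite normr0 powR0// gt_eqF.
have mind : measurable_fun [set: X] (\1_J : X -> R) by exact: measurable_indic.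
have := bound _ mind; rewrite indE => /(_ (muL LJ)); apply: le_trans.
have mk e : pairs e -> measurable_fun [set: X]
    (fun x => alpha e * signed_mean mu (\1_J) e.1 ^+ 2 * \1_(e.2) x).
  by move=> /m2 me; exact: measurable_indic_scale.
apply: ge0_le_integral => //.
- by move=> x _; exact: poweR_ge0.
- apply: (measurable_poweR_esum t0 r).
  + exact: pairs_sub (@charged_sub J).
  + by move=> e /charged_sub/m2 me; exact: measurable_indic_scale.
  + by move=> e x _; rewrite mulr_ge0// beta_sqr_ge0.
- apply: (measurable_poweR_esum t0 r) => //.
  + exact: (parent_child_pairs_countable hL).
  + by move=> e x _; apply: mulr_ge0 (mulr_ge0 (beta_sqr_ge0 _ _) (sqr_ge0 _)) _.
move=> x _; apply: poweR_esum_le => //.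
- by move=> e _; rewrite lee_fin mulr_ge0// beta_sqr_ge0.
move=> e [[Le1 _] eJ e0]; rewrite lee_fin.
suff -> : signed_mean mu (\1_J) e.1 = 1 by rewrite expr1n mulr1.
have mue : mu e.1 \is a fin_num by rewrite ge0_fin_numE// muL.
have me1 := interval_measurable hL Le1.
rewrite /signed_mean /average (negPf e0) /=.
have -> : (\int[mu]_(y in e.1) (EFin \o \1_J) y = mu e.1)%E.
  by rewrite integral_indic//; congr (mu _); apply/setIidPr.
by rewrite -(fineK mue) -EFinM/= mulVf// fine_eq0.
Qed.

Lemma paraproduct_bound_le A A' : 0 <= A -> A <= A' ->
  paraproduct_bound L mu nu p beta A -> paraproduct_bound L mu nu p beta A'.
Proof.
move=> A0 AA' bound f /bound/le_trans; apply.
rewrite lee_wpmul2r ?poweR_ge0// lee_fin.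
by apply: ler_powR2r => //; exact: ltW.
Qed.

Lemma paraproduct_bound_dual A : 0 < A -> paraproduct_bound L mu nu p beta A ->
  dual_testing L mu nu r' beta (necessity_constant r r' * A ^+ 2).
Proof.
move=> A0 /paraproduct_bound_finite bound; apply: finite_testing_dual.
apply: (finite_dual_necessity hL muL nuL _ hp hr hrr' A0 bound).
by move=> e; exact: beta_sqr_ge0.
Qed.

Lemma testing_paraproduct_bound B Bs t : 0 < t -> 0 <= B -> B <= t ->
  0 <= Bs -> Bs <= t ^+ 2 ->
  direct_testing L mu nu p beta B -> dual_testing L mu nu r' beta Bs ->
  paraproduct_bound L mu nu p beta (Num.sqrt (sufficiency_constant p r') * t).
Proof.
move=> t_gt0 B0 Bt Bs0 Bst dir dual; apply/paraproduct_boundE => f mf foo.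
have D0 : 0 < t ^+ 2 by rewrite exprn_gt0.
have fdir : finite_direct_testing mu nu L alpha r (t ^+ 2).
  by apply: direct_testing_finite dir => //; rewrite ler_sqr ?nnegrE// ltW.
have fdual := dual_testing_finite Bs0 Bst dual.
have mabs : measurable_fun [set: X] (fun x => `|f x|) by exact: measurableT_comp.
have suff0 : 0 <= sufficiency_constant p r'.
  by rewrite mulr_ge0// addr_ge0// powR_ge0.
have -> : (Num.sqrt (sufficiency_constant p r') * t) `^ p =
    (sufficiency_constant p r' * t ^+ 2) `^ r.
  by rewrite -powp ?mulr_ge0 ?sqrtr_ge0 ?(ltW t_gt0)// exprMn sqr_sqrtr.
apply: (integral_esum_poweR_le t0) => //.
- exact: (parent_child_pairs_countable hL).
- by move=> e /m2 me; exact: measurable_indic_scale.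
- by move=> e x _; apply: mulr_ge0 (mulr_ge0 (beta_sqr_ge0 _ _) (sqr_ge0 _)) _.
move=> E uE EP; pose E' := [seq e <- E | mu e.1 != 0%E].
have E'P e : e \in E' -> pairs e /\ mu e.1 != 0%E.
  by rewrite mem_filter => /andP[e0 /EP].
have uE' : uniq E' by rewrite filter_uniq.
have floc I : intervals L I -> (\int[mu]_(x in I) (`|f x|)%:E < +oo)%E.
  exact: (abs_integral_lty hL muL p1 mf foo).
have := finite_sufficiency hL muL nuL (beta_sqr_ge0 beta) hp hr hrr' D0 fdir fdual
  mabs (fun x => normr_ge0 (f x)) floc uE' E'P.
apply: le_trans; apply: ge0_le_integral => //.
- by move=> x _; rewrite lee_fin powR_ge0.
- apply/measurable_EFinP/measurable_fun_powR/measurable_sum_seq => e /EP/m2 me.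
  exact: measurable_indic_scale.
- apply/measurable_EFinP/measurable_fun_powR/measurable_sum_seq => e /E'P[/m2 me _].
  exact: measurable_indic_scale.
move=> x _; rewrite lee_fin; apply: ler_powR2r; first exact: ltW.
  rewrite sumr_ge0// => e _.
  by apply: mulr_ge0 (mulr_ge0 (beta_sqr_ge0 _ _) (sqr_ge0 _)) _.
rewrite (bigID (fun e => mu e.1 != 0%E))/= [X in _ + X]big1 ?addr0; last first.
  by move=> e; rewrite negbK => /eqP e0; rewrite signed_mean0// expr0n/= mulr0 mul0r.
rewrite -big_filter big_seq [leRHS]big_seq; apply: ler_sum => e eE'.
have [[Le1 _] e0] := E'P _ eE'.
rewrite ler_wpM2r// ler_wpM2l ?beta_sqr_ge0//.
exact: (signed_mean_le hL muL p1 mf foo Le1 e0).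
Qed.

End conditions.

(** * Best constants *)

Section best_constants.
Context {R : realType}.

Lemma best_constant_ge0 (P : R -> Prop) : (0 <= best_constant P)%E.
Proof. by apply: le_ereal_inf_tmp => _ [a [a0 _] <-]; rewrite lee_fin. Qed.

Lemma best_constant_le (P : R -> Prop) a : 0 <= a -> P a ->
  (best_constant P <= a%:E)%E.
Proof. by move=> a0 Pa; apply: ereal_inf_lbound; exists a. Qed.

Lemma best_constant_lt (P : R -> Prop) a : (best_constant P < a%:E)%E ->
  exists b, [/\ 0 <= b, b < a & P b].
Proof. by move=> /ereal_inf_lt[_ [b [b0 Pb] <-]] ba; exists b. Qed.

End best_constants.

Unset Implicit Arguments.

Theorem theorem1p9 (R : realType) (p r r' : R)
    (hp : 2 < p) (hr : r = p / 2) (hr' : r^-1 + r'^-1 = 1) :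
  exists c C : R, 0 < c /\
    forall (d : measure_display) (X : measurableType d)
      (mu nu : {measure set X -> \bar R}) (S L : int -> set (set X))
      (beta : set X -> set X -> R),
      sigma_finite [set: X] mu ->
      atomic_filtration mu S L ->
      locally_finite L mu -> locally_finite L nu ->
      ((exists A : R, 0 <= A /\ paraproduct_bound L mu nu p beta A) <->
       (exists B Bs : R, [/\ 0 <= B, 0 <= Bs,
          direct_testing L mu nu p beta B &
          dual_testing L mu nu r' beta Bs])) /\
      (let A := best_constant (paraproduct_bound L mu nu p beta) in
       let B := best_constant (direct_testing L mu nu p beta) in
       let Bs := best_constant (dual_testing L mu nu r' beta) in
       (maxe B (c%:E * Bs `^ (1 / 2)) <= A)%E /\
       (A <= C%:E * maxe B (Bs `^ (1 / 2)))%E).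
Proof.
have p0 : 0 < p by apply: lt_trans hp.
have r1 : 1 < r by rewrite hr ltr_pdivlMr// mul1r.
have r0 : 0 < r by exact: lt_trans r1.
have r'0 : 0 < r' by exact: conjugate_gt0 hr'.
have N0 : 0 < necessity_constant r r'.
  apply: powR_gt0; apply: mulr_gt0 => //; apply: powR_gt0; apply: mulr_gt0 => //.
  by apply: mulr_gt0; [exact: powR_gt0|exact: carleson_constant_gt0].
have K0 : 0 < sufficiency_constant p r'.
  apply: mulr_gt0 => //; apply: addr_gt0; apply: carleson_constant_gt0.
    by apply: lt_trans hp; rewrite ltr1n.
  by apply: (conjugate_gt1 r'0 r0); rewrite addrC.
set N := necessity_constant r r' in N0 *.
set C := Num.sqrt (sufficiency_constant p r').
have C0 : 0 < C by rewrite sqrtr_gt0.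
exists (N `^ (- 2^-1)), C; split; first exact: powR_gt0.
move=> d X mu nu S L beta _ hL muL nuL; rewrite div1r.
split.
  split=> [[A [A0 bound]]|[B [Bs [B0 Bs0 dir dual]]]].
    exists A, (N * (A + 1) ^+ 2); split => //.
    - by rewrite mulr_ge0 ?sqr_ge0// ltW.
    - exact: (paraproduct_bound_direct hL muL hp hr).
    - apply: (paraproduct_bound_dual hL muL nuL hp hr hr'); first by rewrite ltr_wpDl.
      by apply: paraproduct_bound_le bound => //; rewrite lerDl.
  pose t := B + Bs + 1.
  have t1 : 1 <= t by rewrite lerDr addr_ge0.
  have t0 : 0 < t by exact: lt_le_trans t1.
  exists (C * t); split; first by rewrite mulr_ge0// ltW.
  apply: (testing_paraproduct_bound hL muL nuL hp hr hr' t0 B0 _ Bs0 _ dir dual).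
  - by rewrite /t -addrA lerDl addr_ge0.
  - apply: (@le_trans _ _ t); first by rewrite /t addrAC lerDr addr_ge0.
    by rewrite expr2 ler_peMr// ltW.
move=> A B Bs; have B0 : (0 <= B)%E by exact: best_constant_ge0.
have Bs0 : (0 <= Bs)%E by exact: best_constant_ge0.
split.
  apply: le_ereal_inf_tmp => _ [a [a0 bound] <-].
  rewrite ge_max; apply/andP; split.
    by apply: best_constant_le => //; exact: (paraproduct_bound_direct hL muL hp hr).
  (* [paraproduct_bound_dual] needs a positive constant, and [a] may be 0. *)
  apply/lee_addgt0Pr => e e0; rewrite -EFinD.
  have ae : 0 < a + e by rewrite ltr_wpDl.
  have : (Bs <= (N * (a + e) ^+ 2)%:E)%E.
    apply: best_constant_le; first by rewrite mulr_ge0 ?sqr_ge0// ltW.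
    apply: (paraproduct_bound_dual hL muL nuL hp hr hr' ae).
    by apply: paraproduct_bound_le bound => //; rewrite lerDl ltW.
  move=> BsN; have : (Bs `^ 2^-1 <= (N * (a + e) ^+ 2)%:E `^ 2^-1)%E.
    apply: gt0_ler_poweR => //.
    - by rewrite in_itv/= Bs0 leey.
    - by rewrite in_itv/= (le_trans Bs0 BsN) leey.
  have c0 : (0 <= (N `^ (- 2^-1))%:E)%E by rewrite lee_fin powR_ge0.
  move=> /(lee_wpmul2l c0)/le_trans; apply.
  rewrite poweR_EFin -EFinM powRM ?sqr_ge0 ?(ltW N0)// mulrA.
  rewrite -powRD; last by rewrite (gt_eqF N0) implybT.
  rewrite addNr powRr0 mul1r -powR_mulrn ?(ltW ae)// -powRrM mulfV// powRr1 ?(ltW ae)//.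
set M := maxe _ _.
have M0 : (0 <= M)%E by rewrite le_max B0.
have BM : (B <= M)%E by rewrite le_max lexx.
have BsM : (Bs `^ 2^-1 <= M)%E by rewrite le_max lexx orbT.
have [->|] := eqVneq M +oo%E; first by rewrite gt0_muley ?lte_fin ?leey.
rewrite -ltey => Moo; have Mfin : M \is a fin_num by rewrite ge0_fin_numE.
rewrite -(fineK Mfin) -EFinM; apply/lee_addgt0Pr => e e0; rewrite -EFinD.
pose t := fine M + e / C.
have eC : 0 < e / C by rewrite divr_gt0.
have t0 : 0 < t by rewrite ltr_wpDl ?fine_ge0.
have Mt : (M < t%:E)%E by rewrite -(fineK Mfin) lte_fin ltrDl.
have [b [b0 bt dir]] := best_constant_lt (le_lt_trans BM Mt).
(* Any [t] above both best constants is admissible for [B] and [Bs `^ 2^-1], hence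
   [C * t] is admissible for [A]. *)
have Bst : (Bs < (t ^+ 2)%:E)%E.
  rewrite ltNge; apply/negP => tBs.
  have : (M < M)%E; last by rewrite ltxx.
  apply: (lt_le_trans Mt); apply: le_trans BsM.
  have -> : t%:E = ((t ^+ 2)%:E `^ 2^-1)%E.
    by rewrite poweR_EFin -powR_mulrn ?(ltW t0)// -powRrM mulfV// powRr1 ?(ltW t0).
  apply: gt0_ler_poweR => //.
  - by rewrite in_itv/= lee_fin sqr_ge0 leey.
  - by rewrite in_itv/= Bs0 leey.
have [bs [bs0 bst dual]] := best_constant_lt Bst.
have -> : C * fine M + e = C * t by rewrite /t mulrDr (mulrC C (e / C)) divfK// gt_eqF.
apply: best_constant_le; first by rewrite mulr_ge0// ltW.
exact: (testing_paraproduct_bound hL muL nuL hp hr hr' t0 b0 (ltW bt) bs0 (ltW bst) dir dual).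
Qed.
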